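(* Let $K$ be an algebraically closed field of characteristic $0$ and $t<m\le n$. Then (1) $\Phi_0$ has cardinality $mn$; (2) $K[\Phi_0][F^{-1}]=A_t[F^{-1}]$; (3) $A_t[F^{-1}]$ is a regular ring.
   Context: $X$ is an $m\times n$ matrix of indeterminates, $A_t\subseteq K[X]$ the $K$-subalgebra generated by the $t$-minors. $\delta_i$ is the minor of $X$ on the first $i$ rows and first $i$ columns ($\delta_0=1$), and $F=\delta_{t-1}\delta_t\delta_{t+1}$. $\Phi_0$ is the set of $t$-minors $[a_1\dots a_t\,|\,b_1\dots b_t]$ ($1\le a_1<\dots<a_t\le m$ rows, $1\le b_1<\dots<b_t\le n$ columns) satisfying at least one of: (i) $a_t\le t+1$ and $b_t\le t+1$; (ii) $a_{t-1}=t-1$ and $b_{t-1}=t-1$; (iii) $a_t=t$ and $b_{t-1}\le t$; (iv) $a_{t-1}\le t$ and $b_t=t$ (for $t=1$ read $a_0=b_0=0$). $K[\Phi_0]$ is the $K$-subalgebra generated by $\Phi_0$. *)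

(* Defs.v *)
From HB Require Import structures.
From mathcomp Require Import all_boot all_order all_algebra.
From mathcomp Require Import fraction.
From mathcomp Require Import mpoly.

Set Implicit Arguments.
Unset Strict Implicit.
Unset Printing Implicit Defensive.

Import GRing.Theory.
Local Open Scope ring_scope.

Section SubringAlgebra.
Variable L : fieldType.
Implicit Types (R I P : L -> Prop).

Definition is_ideal R I : Prop :=
  (forall x, I x -> R x) /\ I 0 /\
  (forall x y, I x -> I y -> I (x + y)) /\
  (forall r x, R r -> I x -> I (r * x)).

Definition prime_ideal R P : Prop :=
  is_ideal R P /\ ~ P 1 /\
  (forall x y, R x -> R y -> P (x * y) -> P x \/ P y).

Definition generated_by R (g : seq L) I : Prop :=
  forall x, I x <-> exists c : nat -> L,
    (forall i, R (c i)) /\ x = \sum_(i < size g) c i * g`_i.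

Definition noetherian R : Prop :=
  forall I, is_ideal R I -> exists g : seq L, generated_by R g I.

Definition has_prime_chain R (d : nat) : Prop :=
  exists P : nat -> L -> Prop,
    (forall i, i <= d -> prime_ideal R (P i))%N /\
    (forall i, i < d ->
       (forall x, P i x -> P i.+1 x) /\ exists x, P i.+1 x /\ ~ P i x)%N.

Definition krull_dim R (d : nat) : Prop :=
  has_prime_chain R d /\ ~ has_prime_chain R d.+1.

Definition localization R P : L -> Prop :=
  fun x => exists a b, R a /\ R b /\ ~ P b /\ x = a / b.
Definition loc_maximal R P : L -> Prop :=
  fun x => exists a b, P a /\ R b /\ ~ P b /\ x = a / b.

Definition regular_local R M : Prop :=
  noetherian R /\
  exists d, krull_dim R d /\ exists g : seq L, size g = d /\ generated_by R g M.

Definition regular_ring R : Prop :=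
  noetherian R /\
  forall P, prime_ideal R P -> regular_local (localization R P) (loc_maximal R P).

Definition invert R (f : L) : L -> Prop :=
  fun x => exists a (k : nat), R a /\ x = a / f ^+ k.

End SubringAlgebra.

Section Minors.
Variables (K : fieldType) (m n t : nat).

Notation P := {mpoly K[m * n]}.

(* entry X_{ij} of the generic m x n matrix (0-indexed); 0 outside *)
Definition Xe (i j : nat) : P :=
  match insub i, insub j with
  | Some i', Some j' => 'X_(mxvec_index (i' : 'I_m) (j' : 'I_n))
  | _, _ => 0
  end.

Definition delta (i : nat) : P := \det (\matrix_(k < i, l < i) Xe k l).

Definition Fdet : P := delta t.-1 * delta t * delta t.+1.

Definition inc_tuples (k : nat) : seq (t.-tuple 'I_k) :=
  [seq a <- enum {: t.-tuple 'I_k} | sorted ltn (map (@nat_of_ord k) (a : t.-tuple 'I_k))].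

Definition minor (a : t.-tuple 'I_m) (b : t.-tuple 'I_n) : P :=
  \det (\matrix_(k < t, l < t) Xe (tnth a k) (tnth b l)).

(* a_k with 1-indexed values, a_0 = 0 *)
Definition idx {k} (a : t.-tuple 'I_k) (i : nat) : nat :=
  if i is i'.+1 then nth 0%N (map (fun x : 'I_k => (val x).+1) a) i' else 0%N.

Definition in_Phi0 (a : t.-tuple 'I_m) (b : t.-tuple 'I_n) : bool :=
  [|| (idx a t <= t.+1)%N && (idx b t <= t.+1)%N,
      (idx a t.-1 == t.-1) && (idx b t.-1 == t.-1),
      (idx a t == t) && (idx b t.-1 <= t)%N
    | (idx a t.-1 <= t)%N && (idx b t == t)].

Definition all_minors : seq P :=
  [seq minor a b | a <- inc_tuples m, b <- inc_tuples n].

Definition Phi0 : seq P :=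
  [seq minor ab.1 ab.2 | ab <- [seq (a, b) | a <- inc_tuples m, b <- inc_tuples n]
                         & in_Phi0 ab.1 ab.2].

End Minors.

Inductive in_subalg (K : fieldType) (N : nat) (G : seq {mpoly K[N]})
  : {mpoly K[N]} -> Prop :=
  | sa_const (c : K) : in_subalg G c%:MP
  | sa_gen g : g \in G -> in_subalg G g
  | sa_add p q : in_subalg G p -> in_subalg G q -> in_subalg G (p + q)
  | sa_mul p q : in_subalg G p -> in_subalg G q -> in_subalg G (p * q).

Definition in_frac (K : fieldType) (N : nat) (S : {mpoly K[N]} -> Prop)
  : {fraction {mpoly K[N]}} -> Prop :=
  fun x => exists p, S p /\ x = FracField.tofrac p.

(* Main.v *)
Require Import Defs.
From HB Require Import structures.
From mathcomp Require Import all_boot all_order all_algebra.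
From mathcomp Require Import fraction.
From mathcomp Require Import mpoly.
From mathcomp Require Import zify ring.
From Stdlib Require Import Classical FunctionalExtensionality PropExtensionality.

(* Let U be the upper-left t x t block of X, with V to its right, W below it and Z opposite, and
   let M = U^-1, a = W M, b = M V, S = Z - W M V, sigma = S_11, N = sigma M, S' = S / sigma and
   d = det U.  The mn quantities a, b, d, N and S'_kl with (k,l) <> (1,1) are the coordinates
   used here.

   - Every t-minor of X is a polynomial in them: up to the sign and the factor d it is the
     determinant of a 2t x 2t matrix whose blocks come from -N, [1 b], [1; a] and S'.
   - Conversely the adjugates of the (t+1)-minors bordering U express d, d a, d b,
     d (N + b_1 a_1) and d (S'_kl N_tt + b_tl a_kt) as elements of Phi_0 up to sign.  Since
     F = d^3 N_tt, all the coordinates lie in K[Phi_0][1/F].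
   - They are algebraically independent: given values with det N and d nonzero, a t-th root of
     d det N serves as sigma, so the coordinates take arbitrary values on a dense open set.

   Hence A_t[1/F] = K[Phi_0][1/F] is a localization of a polynomial ring in mn variables, which
   is regular: for a prime P of K[x_1, ..., x_N], induction on N produces d = N - trdeg(A/P)
   elements generating P locally and a chain of primes of length d below P, while chains of
   length d + 1 would give N + 1 algebraically independent elements. *)

Set Implicit Arguments.
Unset Strict Implicit.
Unset Printing Implicit Defensive.

Import GRing.Theory.
Local Open Scope ring_scope.

(** * Ideals and the Hilbert basis theorem *)

Lemma least_nat (P : nat -> Prop) :
  (exists n, P n) -> exists n, P n /\ forall k, (k < n)%N -> ~ P k.
Proof.
case=> n; elim/ltn_ind: n => n IH Pn.
case: (classic (exists k, (k < n)%N /\ P k)) => [[k [kn Pk]]|H]; first exact: IH kn Pk.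
by exists n; split=> // k kn Pk; apply: H; exists k.
Qed.

Section Ideals.
Variable A : comNzRingType.
Implicit Types (I J P : A -> Prop) (g h : seq A).

(** Ideals as predicates on a whole ring. [is_ideal] and [prime_ideal] are the counterparts for a
    subring of a field, and fractions later mediate between the two. *)
Definition ideal I : Prop :=
  [/\ I 0, forall x y, I x -> I y -> I (x + y) & forall r x, I x -> I (r * x)].

Definition iprime P : Prop :=
  [/\ ideal P, ~ P 1 & forall x y, P (x * y) -> P x \/ P y].

Definition ispan g (x : A) : Prop :=
  exists c : nat -> A, x = \sum_(i < size g) c i * g`_i.

Definition noeth : Prop :=
  forall I, ideal I -> exists g, forall x, I x <-> ispan g x.

Lemma idealN I x : ideal I -> I x -> I (- x).
Proof. by case=> _ _ IM Ix; rewrite -mulN1r; apply: IM. Qed.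

Lemma idealB I x y : ideal I -> I x -> I y -> I (x - y).
Proof. by move=> iI Ix Iy; case: (iI) => _ ID _; apply: ID => //; apply: idealN. Qed.

Lemma ideal_sum I (T : Type) (r : seq T) (Q : pred T) (F : T -> A) :
  ideal I -> (forall i, Q i -> I (F i)) -> I (\sum_(i <- r | Q i) F i).
Proof. by case=> I0 ID _ IF; apply: (big_ind I). Qed.

Lemma ideal_ispan g : ideal (ispan g).
Proof.
split=> [|x y [c ->] [d ->]|r x [c ->]].
- by exists (fun _ => 0); rewrite big1 // => i _; rewrite mul0r.
- exists (fun i => c i + d i); rewrite -big_split /=.
  by apply: eq_bigr => i _; rewrite mulrDl.
- exists (fun i => r * c i); rewrite mulr_sumr.
  by apply: eq_bigr => i _; rewrite mulrA.
Qed.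

Lemma mem_ispan g x : x \in g -> ispan g x.
Proof.
move=> gx; have ig : (index x g < size g)%N by rewrite index_mem.
exists (fun i => (i == index x g)%:R).
rewrite (bigD1 (Ordinal ig)) //= eqxx mul1r nth_index // big1 ?addr0 // => i.
by rewrite -val_eqE /= => /negPf ->; rewrite mul0r.
Qed.

Lemma ispan_min I g : ideal I -> (forall x, x \in g -> I x) -> forall x, ispan g x -> I x.
Proof.
move=> iI gI x [c ->]; apply: ideal_sum => // i _.
by case: iI => _ _; apply; apply: gI; rewrite mem_nth.
Qed.

Lemma ispan_sub g h : {subset g <= h} -> forall x, ispan g x -> ispan h x.
Proof. by move=> gh; apply: ispan_min (ideal_ispan h) _ => x /gh; apply: mem_ispan. Qed.

Lemma ispan_cons a g x : ispan (a :: g) x -> exists c y, ispan g y /\ x = c * a + y.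
Proof.
case=> c ->; rewrite big_ord_recl /=; exists (c 0%N); eexists; split; last by [].
by exists (fun i => c i.+1).
Qed.

Lemma iprime_exp P x k : iprime P -> P (x ^+ k) -> P x.
Proof.
case=> _ P1 PM; elim: k => [|k IH]; first by rewrite expr0.
by rewrite exprS => /PM [].
Qed.

End Ideals.

Lemma noeth_field (K : fieldType) : noeth K.
Proof.
move=> I iI; case: (classic (exists x, I x /\ x != 0)) => [[x [Ix x0]]|H].
  exists [:: x] => y; split=> [_|]; last first.
    by apply: (ispan_min iI) => z; rewrite inE => /eqP ->.
  exists (fun _ => y / x); by rewrite big_ord_recl big_ord0 /= divfK // addr0.
exists [::] => y; split=> [Iy|[c ->]]; last by rewrite big_ord0; case: iI.
exists (fun _ => 0); rewrite big_ord0; apply/eqP/negPn/negP => y0.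
by apply: H; exists y.
Qed.

(** * Finite generation by leading coefficients *)

Section HilbertBasis.
Variable A : comNzRingType.
Hypothesis noethA : noeth A.
Variable I : {poly A} -> Prop.
Hypothesis idI : ideal I.

(** The degree is only bounded by [d], so that the coefficient may vanish; this makes the set an
    ideal. *)
Definition lead_ideal d (a : A) : Prop :=
  exists p, [/\ I p, (size p <= d.+1)%N & p`_d = a].

Lemma ideal_lead d : ideal (lead_ideal d).
Proof.
case: idI => I0 ID IM; split=> [|a b [p [Ip sp <-]] [q [Iq sq <-]]|r a [p [Ip sp <-]]].
- by exists 0; rewrite coef0 size_poly0.
- exists (p + q); split; [exact: ID| |by rewrite coefD].
  by rewrite (leq_trans (size_polyD _ _)) // geq_max sp.
- exists (r%:P * p); split; [exact: IM| |by rewrite coefCM].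
  by rewrite mul_polyC (leq_trans (size_scale_leq _ _)).
Qed.

Lemma lead_idealS d e a : (d <= e)%N -> lead_ideal d a -> lead_ideal e a.
Proof.
case: idI => _ _ IM; move=> de [p [Ip sp <-]]; exists ('X^(e - d) * p); split; first exact: IM.
  by rewrite (leq_trans (size_polyMleq _ _)) // size_polyXn; lia.
by rewrite coefXnM ltnNge leq_subr /= subKn.
Qed.

(** Each generator in [g] is lifted once; a combination of generators is then the degree [d]
    coefficient of the same combination of the lifts. *)
Lemma lead_lift d (g : seq A) : (forall a, a \in g -> lead_ideal d a) ->
  exists G : seq {poly A}, (forall p, p \in G -> I p) /\
    forall a, ispan g a -> exists q, [/\ ispan G q, (size q <= d.+1)%N & q`_d = a].
Proof.
elim: g => [|b g IH] gI.
  exists [::]; split=> // a [c ->]; exists 0; rewrite big_ord0 coef0 size_poly0; split=> //.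
  by case: (ideal_ispan (Nil {poly A})).
have [|G [GI HG]] := IH; first by move=> a ag; apply: gI; rewrite inE ag orbT.
have [p [Ip sp pb]] := gI b (mem_head _ _).
exists (p :: G); split=> [q|a /ispan_cons [c [y [/HG [q [Gq sq qy]] ->]]]].
  by rewrite inE => /orP[/eqP ->|/GI].
have [_ sD sM] := ideal_ispan (p :: G).
exists (c%:P * p + q); split.
- apply: sD; first by apply: sM; apply: mem_ispan; rewrite mem_head.
  by apply: ispan_sub Gq => z; rewrite inE orbC => ->.
- rewrite (leq_trans (size_polyD _ _)) // geq_max sq andbT mul_polyC.
  by rewrite (leq_trans (size_scale_leq _ _)).
- by rewrite coefD coefCM pb qy.
Qed.

(** Induction on [d]: lifts of generators of [lead_ideal d] cancel the coefficient of degree [d],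
    and the rest has smaller degree. *)
Lemma low_degree_fg d : exists G : seq {poly A}, (forall p, p \in G -> I p) /\
  forall p, I p -> (size p <= d)%N -> ispan G p.
Proof.
elim: d => [|d [G [GI HG]]].
  exists [::]; split=> // p _; rewrite leqn0 size_poly_eq0 => /eqP ->.
  by case: (ideal_ispan (Nil {poly A})).
have [g Jg] := noethA (ideal_lead d).
have [|G' [GI' HG']] := @lead_lift d g.
  by move=> a ag; apply/Jg; apply: mem_ispan.
exists (G ++ G'); split=> [p|p Ip sp].
  by rewrite mem_cat => /orP[/GI|/GI'].
have [|q [Gq sq qd]] := HG' p`_d; first by apply/Jg; exists p.
have [_ sD _] := ideal_ispan (G ++ G').
rewrite -[p](subrK q); apply: sD; last first.
  by apply: ispan_sub Gq => z; rewrite mem_cat orbC => ->.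
suff: ispan G (p - q) by apply: ispan_sub => z zG; rewrite mem_cat zG.
apply: HG.
  by apply: idealB => //; apply: (ispan_min idI) Gq.
apply/leq_sizeP => j; rewrite leq_eqVlt => /orP[/eqP <-|dj]; first by rewrite coefB qd subrr.
by rewrite coefB !nth_default ?subr0 // (leq_trans _ dj).
Qed.

(** The union of all [lead_ideal d] is finitely generated, so its generators already occur in one
    degree [D]. Their lifts reduce every element of [I] to size at most [D], where [low_degree_fg]
    applies. *)
Lemma poly_ideal_fg : exists g, forall p, I p <-> ispan g p.
Proof.
have iJ : ideal (fun a => exists d, lead_ideal d a).
  split=> [|a b [d da] [e eb]|r a [d da]].
  - by exists 0%N; case: (ideal_lead 0).
  - exists (maxn d e); case: (ideal_lead (maxn d e)) => _ D _.
    by apply: D; [apply: lead_idealS da|apply: lead_idealS eb]; lia.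
  - by exists d; case: (ideal_lead d) => _ _; apply.
have [g Jg] := noethA iJ.
have [D HD] : exists D, forall a, a \in g -> lead_ideal D a.
  have: forall a, a \in g -> exists d, lead_ideal d a by move=> a /mem_ispan/Jg.
  elim: (g) => [|b h IH] H; first by exists 0%N.
  have [|D HD] := IH; first by move=> a ah; apply: H; rewrite inE ah orbT.
  have [d db] := H b (mem_head _ _).
  exists (maxn d D) => a; rewrite inE => /orP[/eqP ->|/HD aD].
    by apply: lead_idealS db; lia.
  by apply: lead_idealS aD; lia.
have [G1 [GI1 HG1]] := lead_lift HD.
have [G2 [GI2 HG2]] := low_degree_fg D.
exists (G1 ++ G2) => p; split; last first.
  by apply: (ispan_min idI) => q; rewrite mem_cat => /orP[/GI1|/GI2].
have [_ sD sM] := ideal_ispan (G1 ++ G2).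
have [k] := ubnP (size p); elim: k p => // k IH p; rewrite ltnS => sp Ip.
case: (leqP (size p) D) => [sD'|lDp].
  by apply: ispan_sub (HG2 _ Ip sD') => z; rewrite mem_cat orbC => ->.
have [e se] : exists e, size p = e.+1 by exists (size p).-1; lia.
have [|q [Gq sq qD]] := HG1 p`_e.
  by apply/Jg; exists e, p; rewrite se.
(* The shift by [e - D] moves the leading term of [q] onto that of [p]. *)
have Gq' : ispan (G1 ++ G2) ('X^(e - D) * q).
  by apply: sM; apply: ispan_sub Gq => z; rewrite mem_cat => ->.
rewrite -[p](subrK ('X^(e - D) * q)); apply: sD => //.
apply: IH; last first.
  apply: idealB => //; apply: (ispan_min idI _ Gq') => r.
  by rewrite mem_cat => /orP[/GI1|/GI2].
rewrite (leq_trans _ sp) // se ltnS; apply/leq_sizeP => j.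
rewrite coefB coefXnM leq_eqVlt => /orP[/eqP <-|ej].
  by rewrite ltnNge leq_subr /= subKn ?qD ?subrr // -ltnS -se.
rewrite [p`_j]nth_default ?se // sub0r; case: ifP => [|_]; first by rewrite oppr0.
by rewrite nth_default ?oppr0 // (leq_trans sq) //; lia.
Qed.

End HilbertBasis.

Lemma noeth_poly (A : comNzRingType) : noeth A -> noeth {poly A}.
Proof. by move=> nA I iI; apply: poly_ideal_fg. Qed.

(** * Primes of iterated polynomial rings *)

Section PolyPrimes.
Variable A : idomainType.
Implicit Types (P : {poly A} -> Prop) (Q : A -> Prop).

Definition contract P (a : A) : Prop := P a%:P.
(** The ideal generated by [Q] in the polynomial ring, described by coefficients. *)
Definition extend Q (p : {poly A}) : Prop := forall i, Q p`_i.

Lemma iprime_contract P : iprime P -> iprime (contract P).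
Proof.
case=> [[P0 PD PM] P1 Pp]; split; last by move=> x y; rewrite /contract polyCM; apply: Pp.
  by split=> [|x y Px Py|r x Px]; rewrite /contract ?polyCD ?polyCM //; [apply: PD|apply: PM].
by rewrite /contract polyC1.
Qed.

Lemma ideal_extend Q : ideal Q -> ideal (extend Q).
Proof.
move=> iQ; case: (iQ) => Q0 QD QM; split=> [i|p q Pp Pq i|r p Pp i].
- by rewrite coef0.
- by rewrite coefD; apply: QD.
- by rewrite coefM; apply: ideal_sum => // j _; apply: QM.
Qed.

(** As in Gauss's lemma: for the least [i] and [j] with [p_i] and [q_j] outside [Q], every other
    summand of the coefficient [i + j] of [p * q] lies in [Q]. *)
Lemma iprime_extend Q : iprime Q -> iprime (extend Q).
Proof.
case=> iQ Q1 Qp; split; first exact: ideal_extend.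
  by move=> /(_ 0%N); rewrite coef1.
move=> p q Hpq; apply: NNPP => /not_or_and [np nq].
have [i [Pi Hi]] := least_nat (not_all_ex_not _ _ np).
have [j [Pj Hj]] := least_nat (not_all_ex_not _ _ nq).
suff: Q (p`_i * q`_j) by case/Qp.
have := Hpq (i + j)%N; rewrite coefM.
have ltij : (i < (i + j).+1)%N by lia.
rewrite (bigD1 (Ordinal ltij)) //= addKn => H.
rewrite -[_ * _](addrK (\sum_(k < (i + j).+1 | k != Ordinal ltij) p`_k * q`_(i + j - k))).
apply: idealB => //; apply: ideal_sum => // k.
rewrite -val_eqE /= neq_ltn; case: iQ => _ _ QM => /orP[ki|ik].
  by rewrite mulrC; apply: QM; apply: NNPP; apply: Hi.
by apply: QM; apply: NNPP; apply: Hj; have := ltn_ord k; lia.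
Qed.

Lemma extend_contract_sub P p : ideal P -> extend (contract P) p -> P p.
Proof.
move=> iP Hp; rewrite -[p]coefK poly_def; apply: ideal_sum => // i _.
by rewrite -mul_polyC mulrC; case: iP => _ _; apply; apply: Hp.
Qed.

(* Modulo [contract P], the ideal [P] becomes an ideal of a polynomial ring over a domain:
   an element of least degree generates it after inverting leading coefficients. *)
Lemma prime_pseudo_principal P : iprime P -> ~ (forall p, P p -> extend (contract P) p) ->
  exists f, [/\ P f, ~ extend (contract P) f &
    forall g, P g -> exists c q r,
      [/\ ~ contract P c, extend (contract P) r & c%:P * g = q * f + r]].
Proof.
move=> prP H; have [iP P1 Pp] := prP; have [iQ _ _] := iprime_contract prP.
have [f0 Hf0] := not_all_ex_not _ _ H; have [Pf0 nf0] := imply_to_and _ _ Hf0.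
pose bad k := exists f, [/\ P f, ~ extend (contract P) f & size f = k].
have [|k [[f [Pf nf <-]] fmin]] := @least_nat bad; first by exists (size f0), f0.
have f_neq0 : f != 0.
  by apply/eqP => f0'; apply: nf => i; rewrite f0' coef0; case: iQ.
have small p : P p -> (size p < size f)%N -> extend (contract P) p.
  by move=> Pp' sp; apply: NNPP => np; apply: (fmin _ sp); exists p.
(* Otherwise the leading term would lie in [P], and removing it would leave an element of smaller
   size, hence of the extended ideal, forcing [f] into it. *)
have nlead : ~ contract P (lead_coef f).
  move=> Pl; pose l := (lead_coef f)%:P * 'X^((size f).-1).
  have Pl' : P l by rewrite /l mulrC; case: iP => _ _; apply.
  apply: nf => i; rewrite -[f](subrK l) coefD; case: (iQ) => _ + _; apply; last first.
    rewrite /l coefCM coefXn; case: eqP => _; first by rewrite mulr1.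
    by rewrite mulr0; case: iQ.
  apply: small; first exact: idealB.
  rewrite -[X in (_ < X)%N]prednK ?size_poly_gt0 // ltnS; apply/leq_sizeP => j.
  rewrite /l coefB coefCM coefXn leq_eqVlt => /orP[/eqP <-|lj].
    by rewrite eqxx mulr1 subrr.
  by rewrite gtn_eqF // mulr0 subr0 nth_default //; apply: leq_trans lj; apply: leqSpred.
exists f; split=> // g Pg.
(* Pseudo-division: [g] is multiplied by a power of the leading coefficient of [f], which stays
   outside the prime, and the remainder is too small to escape the extended ideal. *)
have Eg := Pdiv.Idomain.divp_eq g f.
exists (lead_coef f ^+ Pdiv.Idomain.scalp g f), (g %/ f), (g %% f); split.
- by move=> /(iprime_exp (iprime_contract prP)).
- apply: small; last by rewrite Pdiv.Idomain.ltn_modp.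
  have -> : g %% f = (lead_coef f ^+ Pdiv.Idomain.scalp g f)%:P * g - g %/ f * f.
    by rewrite mul_polyC Eg addrAC subrr add0r.
  by case: (iP) => _ _ PM; apply: idealB => //; apply: PM.
- by rewrite mul_polyC Eg.
Qed.

End PolyPrimes.

(** * Polynomial rings in n variables, and induction on n *)

Section IteratedPolynomials.
Variable K : fieldType.

(** The ring K[x_0, ..., x_(n-1)] with the last variable outermost, so that induction on [n] is the
    passage from a domain to its univariate polynomials. *)
Fixpoint T n : idomainType := if n is k.+1 then {poly (T k)} : idomainType else K.

Section Eval.
Variables (R : comNzRingType) (iota : {rmorphism K -> R}) (y : nat -> R).

Fixpoint ev n : {rmorphism T n -> R} :=
  match n with
  | 0 => iota
  | k.+1 => (horner_eval (y k) \o map_poly (ev k))%FUN : {rmorphism {poly T k} -> R}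
  end.

Lemma evS n (p : T n.+1) : ev n.+1 p = (map_poly (ev n) (p : {poly T n})).[y n].
Proof. by []. Qed.

End Eval.

Lemma eq_ev (R : comNzRingType) (iota iota' : {rmorphism K -> R}) (y y' : nat -> R) n :
  iota =1 iota' -> (forall i, (i < n)%N -> y i = y' i) -> ev iota y n =1 ev iota' y' n.
Proof.
move=> Ei; elim: n => [|n IH] Ey p; first exact: Ei.
rewrite !evS Ey //; congr (_.[_]); apply: eq_map_poly; apply: IH => i ni.
by apply: Ey; rewrite ltnS ltnW.
Qed.

Lemma rmorph_ev (R S : comNzRingType) (f : {rmorphism R -> S}) (iota : {rmorphism K -> R})
    (y : nat -> R) n p :
  f (ev iota y n p) = ev (f \o iota)%FUN (f \o y) n p.
Proof.
elim: n p => [|n IH] p //; rewrite !evS -horner_map /= -map_poly_comp.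
by congr (_.[_]); apply: eq_map_poly.
Qed.

Fixpoint cst n : {rmorphism K -> T n} :=
  match n with
  | 0 => idfun
  | k.+1 => (@polyC (T k) \o cst k)%FUN : {rmorphism K -> {poly T k}}
  end.

Lemma ev_cst (R : comNzRingType) (iota : {rmorphism K -> R}) y n c :
  ev iota y n (cst n c) = iota c.
Proof. by elim: n => [|n IH] //; rewrite evS /= map_polyC hornerC; apply: IH. Qed.

Lemma noeth_T n : noeth (T n).
Proof. by elim: n => [|n IH]; [apply: noeth_field|apply: noeth_poly]. Qed.

(** The residues of [y 0], ..., [y (e - 1)] modulo [P] are algebraically independent over [K]. *)
Definition indep_mod (n : nat) (P : T n -> Prop) e (y : nat -> T n) : Prop :=
  forall p : T e, P (ev (cst n) y e p) -> p = 0.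

(** Generation of [P] in the local ring at [P], stated without fractions. *)
Definition gen_at (A : comNzRingType) (P : A -> Prop) (g : seq A) : Prop :=
  (forall x, x \in g -> P x) /\
  forall x, P x -> exists c, ~ P c /\ ispan g (c * x).

Definition chain_to (A : comNzRingType) (P : A -> Prop) d (Q : nat -> A -> Prop) : Prop :=
  [/\ forall i, (i <= d)%N -> iprime (Q i),
      forall i, (i < d)%N -> (forall x, Q i x -> Q i.+1 x) /\ exists x, Q i.+1 x /\ ~ Q i x
    & forall x, Q d x <-> P x].

(** Every coefficient has its own denominator outside [Q]; their product serves for the whole
    polynomial. *)
Lemma gen_at_extend (A : idomainType) (Q : A -> Prop) (g : seq A) :
  iprime Q -> gen_at Q g -> forall p : {poly A}, extend Q p ->
  exists c, ~ Q c /\ ispan (map polyC g) (c%:P * p).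
Proof.
move=> [iQ Q1 Qp] [_ gQ]; have [s0 sD sM] := ideal_ispan (map polyC g).
apply: poly_ind => [|p a IH] Hp; first by exists 1; rewrite mulr0.
have [i|c [nc Hc]] := IH.
  by have := Hp i.+1; rewrite coefD coefMX coefC /= addr0.
have [|b [nb [e Eb]]] := gQ a.
  by have := Hp 0%N; rewrite coefD coefMX coefC /= add0r.
exists (c * b); split; first by case/Qp.
rewrite mulrDr; apply: sD.
  have -> : (c * b)%:P * (p * 'X) = ('X * b%:P) * (c%:P * p) by rewrite polyCM; ring.
  exact: sM.
have -> : (c * b)%:P * a%:P = c%:P * (b * a)%:P by rewrite -!polyCM mulrA.
apply: sM; rewrite Eb; exists (fun i => (e i)%:P); rewrite size_map rmorph_sum /=.
by apply: eq_bigr => i _; rewrite polyCM (nth_map 0).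
Qed.

Lemma ev_polyC n y e p :
  ev (cst n.+1) (fun i => (y i)%:P) e p = (ev (cst n) y e p)%:P :> {poly T n}.
Proof. by rewrite (rmorph_ev (@polyC (T n))). Qed.

(** Here [d] plays the role of the height of [P] and [e] that of the transcendence degree of the
    quotient. With [Q] the contraction of [P], either [P] is the extension of [Q] and the new
    variable is independent modulo [P], or one element [f] from [prime_pseudo_principal] is added to
    the generators and [P] to the top of the extended chain. *)
Lemma prime_structure n (P : T n -> Prop) : iprime P ->
  exists d e g Q y, [/\ n = (d + e)%N, size g = d, gen_at P g, chain_to P d Q & indep_mod P e y].
Proof.
elim: n P => [|n IH] P prP.
  exists 0%N, 0%N, [::], (fun _ => P), (fun _ => 0); split=> //.
    split=> // x Px; exists 1; split; first by case: prP.
    suff -> : x = 0 by rewrite mulr0; case: (ideal_ispan (Nil K)).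
    apply/eqP/negPn/negP => x0; case: prP => [[_ _ PM]] P1 _; apply: P1.
    by rewrite -(mulVf x0); apply: PM.
  move=> p /= Px; apply/eqP/negPn/negP => x0; case: prP => [[_ _ PM]] P1 _; apply: P1.
  by rewrite -(mulVf x0); apply: PM.
have prQ := iprime_contract prP; set Q := contract P in prQ.
have [d [e [g [C [y [En sg [gP gQ] [Cp Cs Cd] indy]]]]]] := IH _ prQ.
have iP : ideal P by case: prP.
have Cx i : (i < d)%N -> (forall x, extend (C i) x -> extend (C i.+1) x) /\
    exists x, extend (C i.+1) x /\ ~ extend (C i) x.
  move=> id; have [sub [x [x1 x2]]] := Cs i id; split=> [p Hp j|]; first exact/sub/Hp.
  exists x%:P; split; last by move=> /(_ 0%N); rewrite coefC.
  move=> j; rewrite coefC; case: ifP => // _.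
  by have [[]] := Cp i.+1 id.
case: (classic (forall p, P p -> extend Q p)) => [PQ|nPQ].
  exists d, e.+1, (map polyC g), (fun i => extend (C i)).
  exists (fun i => if (i < e)%N then (y i)%:P else 'X); split.
  - by rewrite En addnS.
  - by rewrite size_map.
  - split=> [x /mapP[z /gP Qz ->] //|x /PQ Qx].
    by have [c [nc Hc]] := gen_at_extend prQ (conj gP gQ) Qx; exists c%:P.
  - split=> // [i id|x]; first exact/iprime_extend/Cp.
    split=> [H|/PQ H i]; last exact/Cd.
    by apply: extend_contract_sub => // i; apply/Cd.
  - move=> p; rewrite evS ltnn => /PQ.
    (* The last variable goes to itself and the others to constants, so a relation modulo [extend Q]
       is a relation modulo [Q] in each coefficient. *)
    rewrite (@eq_map_poly _ _ _ (polyC \o ev (cst n) y e)%FUN); last first.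
      move=> x /=; rewrite -ev_polyC; apply: eq_ev => // i ie; by rewrite ie.
    rewrite (@map_poly_comp _ _ _ polyC) /= -[_.[_]]/(_ \Po 'X) comp_polyXr => H.
    apply/polyP => i; rewrite coef0; apply: indy.
    by have := H i; rewrite coef_map.
have [f [Pf nf Hf]] := prime_pseudo_principal prP nPQ.
(* The term of index [d] is [extend Q]; the last inclusion is strict because of [f]. *)
exists d.+1, e, (f :: map polyC g), (fun i => if (i <= d)%N then extend (C i) else P).
exists (fun i => (y i)%:P); split.
- by rewrite En addSn.
- by rewrite /= size_map sg.
- split=> [x|x Px].
    by rewrite inE => /orP[/eqP -> //|/mapP[z /gP Qz ->]].
  have [c [q [r [nc Qr E]]]] := Hf x Px.
  have [b [nb Hb]] := gen_at_extend prQ (conj gP gQ) Qr.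
  exists (b * c)%:P; split; first by case: prQ => _ _ Qp /Qp [].
  have [_ sD sM] := ideal_ispan (f :: map polyC g).
  rewrite polyCM -mulrA E mulrDr; apply: sD.
    by rewrite mulrA; apply: sM; apply: mem_ispan; rewrite mem_head.
  by apply: ispan_sub Hb => z zg; rewrite inE zg orbT.
- split=> [i _|i|x]; last by rewrite ltnn.
    by case: ifP => // id; apply/iprime_extend/Cp.
  rewrite ltnS => id; rewrite id; case: ltnP => di; first exact: Cx.
  have -> : i = d by apply/eqP; rewrite eqn_leq id.
  have CQ p : extend (C d) p <-> extend Q p by split=> H j; apply/Cd.
  split=> [p /CQ|]; first exact: extend_contract_sub.
  by exists f; split=> // /CQ.
- by move=> p; rewrite ev_polyC; apply: indy.
Qed.

End IteratedPolynomials.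

(** * Algebraic dependence and the length of prime chains *)

Section AlgebraicDependence.
Variable K : fieldType.
Local Notation T := (T K).

(** Degree at most [B] in each variable separately. *)
Fixpoint deg_le n (B : nat) : T n -> Prop :=
  match n with
  | 0 => fun _ => True
  | k.+1 => fun p : {poly T k} => (size p <= B.+1)%N /\ forall i, deg_le B p`_i
  end.

Lemma deg_le0 n B : @deg_le n B 0.
Proof. by elim: n => [|n IH] //=; split=> [|i]; rewrite ?size_poly0 ?coef0. Qed.

Lemma deg_leD n B (p q : T n) : deg_le B p -> deg_le B q -> deg_le B (p + q).
Proof.
elim: n p q => [|n IH] //= p q [sp Hp] [sq Hq]; split=> [|i].
  by rewrite (leq_trans (size_polyD _ _)) // geq_max sp.
by rewrite coefD; apply: IH.
Qed.

Lemma deg_leW n B B' (p : T n) : (B <= B')%N -> deg_le B p -> deg_le B' p.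
Proof.
move=> BB'; elim: n p => [|n IH] //= p [sp Hp]; split=> [|i]; last exact: IH.
exact: leq_trans sp _.
Qed.

Lemma deg_leM n B B' (p q : T n) : deg_le B p -> deg_le B' q -> deg_le (B + B') (p * q).
Proof.
elim: n p q => [|n IH] //= p q [sp Hp] [sq Hq]; split=> [|i].
  by rewrite (leq_trans (size_polyMleq _ _)) // -subn1 leq_subLR add1n -addSn -addnS leq_add.
rewrite coefM; apply: (big_ind (@deg_le n (B + B'))) => [||j _]; first exact: deg_le0.
  by move=> ? ?; apply: deg_leD.
exact: IH.
Qed.

Lemma deg_le_cst n c : deg_le 0 (cst K n c).
Proof.
elim: n => [|n IH] //=; split=> [|i]; first by rewrite size_polyC leq_b1.
by rewrite coefC; case: ifP => _ //; apply: deg_le0.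
Qed.

Lemma deg_leX n B (p : T n) k : deg_le B p -> deg_le (k * B) (p ^+ k).
Proof.
move=> Hp; elim: k => [|k IH]; last by rewrite exprS mulSn; apply: deg_leM.
by rewrite expr0 mul0n -(rmorph1 (cst K n)); apply: deg_le_cst.
Qed.

Lemma deg_le_ex n (p : T n) : exists B, deg_le B p.
Proof.
elim: n p => [|n IH] p; first by exists 0%N.
have [B HB] : exists B, forall i, (i < size (p : {poly T n}))%N -> deg_le B (p : {poly T n})`_i.
  elim: (size _) => [|k [B HB]]; first by exists 0%N.
  have [B' HB'] := IH (p : {poly T n})`_k; exists (maxn B B') => i.
  rewrite ltnS leq_eqVlt => /orP[/eqP ->|/HB Hi].
    by apply: deg_leW HB'; rewrite leq_maxr.
  by apply: deg_leW Hi; rewrite leq_maxl.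
exists (maxn B (size (p : {poly T n}))) => /=; split=> [|i].
  by apply: leqW; rewrite leq_maxr.
case: (ltnP i (size (p : {poly T n}))) => [/HB Hi|si]; last by rewrite nth_default //; apply: deg_le0.
by apply: deg_leW Hi; rewrite leq_maxl.
Qed.

(** Each of the [e] variables has exponent at most [D], and each occurrence contributes degree at
    most [B]. *)
Lemma deg_le_ev n B D e (y : nat -> T n) (p : T e) :
  (forall i, (i < e)%N -> deg_le B (y i)) -> deg_le D p ->
  deg_le (e * D * B) (ev (cst K n) y e p).
Proof.
elim: e p => [|e IH] p Hy Hp; first exact: deg_le_cst.
case: Hp => sp Hp; rewrite evS horner_poly.
apply: (big_ind (@deg_le n (e.+1 * D * B))) => [||[j /= sj] _]; first exact: deg_le0.
  by move=> ? ?; apply: deg_leD.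
have sj' : (j <= D)%N by rewrite -ltnS (leq_trans sj).
apply: (@deg_leW _ (e * D * B + j * B)%N).
  by rewrite -mulnDl leq_mul2r mulSn addnC leq_add2r sj' orbT.
apply: deg_leM; last by apply: deg_leX; apply: Hy.
by apply: IH; [move=> i ie; apply: Hy; rewrite ltnS ltnW|apply: Hp].
Qed.

(** Defined by recursion so that it unfolds to the product that [vec_mx] expects in [of_coefs]; the
    closed form follows in [ncoefE]. *)
Fixpoint ncoef (D n : nat) : nat := if n is k.+1 then D.+1 * ncoef D k else 1.

Lemma ncoefE D n : ncoef D n = (D.+1 ^ n)%N.
Proof. by elim: n => //= n ->; rewrite expnS. Qed.

Fixpoint of_coefs D n : 'rV[K]_(ncoef D n) -> T n :=
  match n with
  | 0 => fun v => v 0 0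
  | k.+1 => fun v => (\poly_(i < D.+1) of_coefs (row (inord i) (vec_mx v)) : {poly T k})
  end.

Lemma of_coefsP D n a (u v : 'rV[K]_(ncoef D n)) :
  of_coefs (a *: u + v) = cst K n a * of_coefs u + of_coefs v.
Proof.
elim: n u v => [|n IH] u v; first by rewrite /= !mxE.
apply/polyP => i; rewrite /= coefD coefCM !coef_poly; case: ltnP => _; last by rewrite mulr0 addr0.
by rewrite !linearP /= IH.
Qed.

Lemma of_coefs0 D n : of_coefs (0 : 'rV[K]_(ncoef D n)) = 0.
Proof.
have := of_coefsP 1 (0 : 'rV[K]_(ncoef D n)) 0; rewrite scaler0 addr0 rmorph1 mul1r.
by move/eqP; rewrite -subr_eq subrr => /eqP <-.
Qed.

Lemma of_coefs_sum D n I (r : seq I) (c : I -> K) (v : I -> 'rV[K]_(ncoef D n)) :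
  of_coefs (\sum_(i <- r) c i *: v i) = \sum_(i <- r) cst K n (c i) * of_coefs (v i).
Proof.
elim: r => [|i r IH]; first by rewrite !big_nil of_coefs0.
by rewrite !big_cons of_coefsP IH.
Qed.

Lemma of_coefs_inj D n (u : 'rV[K]_(ncoef D n)) : of_coefs u = 0 -> u = 0.
Proof.
elim: n u => [|n IH] u /=; first by move=> H; apply/rowP => i; rewrite ord1 mxE.
move=> H; rewrite -[u]vec_mxK -[X in mxvec X](_ : 0 = _) ?linear0 //.
apply/row_matrixP => i; rewrite row0; apply/esym/IH.
by have := congr1 (fun p : {poly T n} => p`_i) H; rewrite coef_poly ltn_ord coef0 inord_val.
Qed.

Lemma of_coefs_surj D n (p : T n) : deg_le D p -> exists u : 'rV[K]_(ncoef D n), of_coefs u = p.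
Proof.
elim: n p => [|n IH] p; first by exists (\row_(_ < 1) p); rewrite /= mxE.
case=> sp Hp; have [u Hu] := fin_all_exists (fun i : 'I_D.+1 => IH _ (Hp i)).
exists (mxvec (\matrix_i u i)); apply/polyP => i; rewrite /= coef_poly mxvecK.
case: ltnP => iD; last by rewrite nth_default // (leq_trans sp).
by rewrite rowK Hu inordK.
Qed.

(* There are [D.+1 ^ n.+1] monomials in [y] with exponents at most [D], and they all lie in a
   space whose dimension is [O(D ^ n)]. *)
Lemma algebraic_dependence n (y : nat -> T n) :
  exists p : T n.+1, ev (cst K n) y n.+1 p = 0 /\ p <> 0.
Proof.
have [B HB] : exists B, forall i, (i < n.+1)%N -> deg_le B (y i).
  elim: n.+1 => [|k [B HB]]; first by exists 0%N.
  have [B' HB'] := deg_le_ex (y k); exists (maxn B B') => i.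
  rewrite ltnS leq_eqVlt => /orP[/eqP ->|/HB Hi].
    by apply: deg_leW HB'; rewrite leq_maxr.
  by apply: deg_leW Hi; rewrite leq_maxl.
(* With c = (n + 1) B + 1 this [D] is c^n, whence (B' + 1)^n <= c^n (D + 1)^n = D (D + 1)^n < (D +
   1)^(n + 1). *)
pose D := ((n.+1 * B).+1 ^ n)%N; pose B' := (n.+1 * D * B)%N.
have lt_dim : (ncoef B' n < ncoef D n.+1)%N.
  rewrite !ncoefE (@leq_ltn_trans (((n.+1 * B).+1 * D.+1) ^ n)%N) //.
    suff: (B'.+1 <= (n.+1 * B).+1 * D.+1)%N.
      move: B'.+1 ((n.+1 * B).+1 * D.+1)%N => u v uv.
      by case: (n) => [|k]; rewrite ?expn0 ?leq_exp2r.
    by rewrite mulSn addSn ltnS /B' mulnAC mulnS; lia.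
  by rewrite expnMn expnS ltn_pmul2r ?expn_gt0.
(* The unit vector [delta_mx 0 i] encodes the i-th monomial; [w] collects the coefficients of its
   value at [y]. A row of the kernel of these vectors is the relation sought. *)
have Hex (i : 'I_(ncoef D n.+1)) :
    exists w : 'rV_(ncoef B' n), of_coefs w = ev (cst K n) y n.+1 (of_coefs (delta_mx 0 i)).
  apply: of_coefs_surj; apply: deg_le_ev => //.
  elim: n.+1 (delta_mx 0 i) => [|k IH] u //=; split=> [|j]; first exact: size_poly.
  by rewrite coef_poly; case: ifP => _; [apply: IH|apply: deg_le0].
have [w Hw] := fin_all_exists Hex.
pose M := \matrix_i w i; have: kermx M != 0.
  rewrite kermx_eq0 /row_free; apply/eqP => E.
  by have := rank_leq_col M; rewrite E leqNgt lt_dim.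
rewrite -nz_row_eq0; set u := nz_row _ => u0.
have uM : u *m M = 0 by apply/sub_kermxP; apply: nz_row_sub.
exists (of_coefs u); split; last by move/of_coefs_inj/eqP; apply/negP.
rewrite (row_sum_delta u) of_coefs_sum rmorph_sum /=.
transitivity (of_coefs (u *m M)); last by rewrite uM of_coefs0.
rewrite mulmx_sum_row of_coefs_sum; apply: eq_bigr => i _.
rewrite rowK Hw; apply: etrans (rmorphM (ev (cst K n) y n.+1) _ _) _.
by congr (_ * _); apply: ev_cst.
Qed.

(** In a relation modulo [P] the term free of the last variable lies in [P'], as [f] does, so it
    vanishes by independence. The rest is divisible by the last variable, whose value [f] cancels
    since [P] is prime and omits [f]. *)
Lemma indep_mod_extend n (P P' : T n -> Prop) e y f :
  iprime P -> iprime P' -> (forall x, P x -> P' x) -> P' f -> ~ P f ->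
  indep_mod P' e y -> indep_mod P e.+1 (fun i => if (i < e)%N then y i else f).
Proof.
move=> [iP P1 Pp] [iP' _ _] PP' P'f nPf indy.
have Eev (c : T e) : ev (cst K n) (fun i => if (i < e)%N then y i else f) e c = ev (cst K n) y e c.
  by apply: eq_ev => // i ->.
apply: poly_ind => // p c IH.
have -> : ev (cst K n) (fun i => if (i < e)%N then y i else f) e.+1 (p * 'X + c%:P) =
          ev (cst K n) (fun i => if (i < e)%N then y i else f) e.+1 p * f + ev (cst K n) y e c.
  rewrite !evS rmorphD rmorphM /= map_polyX map_polyC hornerD hornerM hornerX hornerC ltnn.
  by congr (_ + _); apply: Eev.
move=> H; have c0 : c = 0.
  apply: indy; rewrite -[ev _ _ _ _](addKr (ev (cst K n)
    (fun i => if (i < e)%N then y i else f) e.+1 p * f)) addrC.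
  apply: idealB => //; first exact: PP'.
  by case: iP' => _ _; apply.
by move: H; rewrite c0 rmorph0 !addr0 => /Pp [/IH ->|//]; rewrite mul0r.
Qed.

(** Each step down the chain adds one independent element, so modulo [Q 0] there would be e + d + 1
    = n + 1 of them, against [algebraic_dependence]. *)
Lemma no_longer_chain n (P : T n -> Prop) d e y (Q : nat -> T n -> Prop) :
  n = (d + e)%N -> indep_mod P e y ->
  (forall i, (i <= d.+1)%N -> iprime (Q i)) ->
  (forall i, (i < d.+1)%N -> (forall x, Q i x -> Q i.+1 x) /\ exists x, Q i.+1 x /\ ~ Q i x) ->
  (forall x, Q d.+1 x -> P x) -> False.
Proof.
move=> En indy Qp Qs QP.
(* The index is written as a difference so that induction on the subtrahend descends from [Q d.+1]
   to [Q 0]. *)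
have [z Hz] : exists z, indep_mod (Q (d.+1 - d.+1)%N) (e + d.+1) z.
  have: (d.+1 <= d.+1)%N by [].
  elim: {1 4 5}d.+1 => [|j IH] jd.
    by exists y; rewrite subn0 addn0 => p Hp; apply: indy; apply: QP.
  have [z Hz] := IH (ltnW jd); have [sub [f [f1 f2]]] := Qs (d.+1 - j.+1)%N ltac:(lia).
  rewrite subnSK // in sub f1; rewrite addnS.
  eexists; apply: indep_mod_extend sub f1 f2 Hz; apply: Qp; lia.
rewrite subnn addnS addnC -En in Hz.
have [p [Ep p0]] := algebraic_dependence z.
by apply: p0; apply: Hz; rewrite Ep; case: (Qp 0%N isT) => [[]].
Qed.

End AlgebraicDependence.

(** * Regularity of localizations *)

Section Fractions.
Variables (A : idomainType) (L : fieldType) (phi : {rmorphism A -> L}).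
Hypothesis phi_inj : injective phi.

Definition fractions (I W : A -> Prop) (x : L) : Prop :=
  exists a b, [/\ I a, W b & x = phi a / phi b].

Definition denominators (W : A -> Prop) : Prop :=
  [/\ W 1, forall b c, W b -> W c -> W (b * c) & forall b, W b -> phi b != 0].

Local Notation loc := (fractions (fun _ => True)).

Lemma fractions1 I (W : A -> Prop) a : W 1 -> I a -> fractions I W (phi a).
Proof. by move=> W1 Ia; exists a, 1; rewrite rmorph1 divr1. Qed.

Lemma is_ideal_fractions I W : denominators W -> ideal I -> is_ideal (loc W) (fractions I W).
Proof.
move=> [W1 WM W0] iI; have [I0 ID IM] := iI; split; last split; last split.
- by move=> x [a [b [_ Wb ->]]]; exists a, b.
- by exists 0, 1; rewrite rmorph0 mul0r.
- move=> x y [a [b [Ia Wb ->]]] [c [d [Ic Wd ->]]].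
  exists (d * a + b * c), (b * d); split; [by apply: ID; apply: IM|exact: WM|].
  by rewrite rmorphD !rmorphM; field; rewrite !W0.
- move=> r x [a [b [_ Wb ->]]] [c [d [Ic Wd ->]]].
  exists (a * c), (b * d); split; [exact: IM|exact: WM|].
  by rewrite !rmorphM; field; rewrite !W0.
Qed.

Lemma contract_ideal W J : denominators W -> is_ideal (loc W) J -> ideal (fun a => J (phi a)).
Proof.
move=> [W1 _ _] [JR [J0 [JD JM]]]; split; rewrite ?rmorph0 //.
  by move=> x y Jx Jy; rewrite rmorphD; apply: JD.
by move=> r x Jx; rewrite rmorphM; apply: JM => //; apply: fractions1.
Qed.

Lemma is_ideal_numerator W J a b :
  denominators W -> is_ideal (loc W) J -> W b -> J (phi a / phi b) <-> J (phi a).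
Proof.
move=> [W1 _ W0] [JR [J0 [JD JM]]] Wb; split=> H.
  by rewrite -[phi a](divfK (W0 _ Wb)) mulrC; apply: JM => //; apply: fractions1.
by rewrite mulrC; apply: JM => //; exists 1, b; rewrite rmorph1 mul1r.
Qed.

Lemma generated_fractions W (g : seq A) J :
  denominators W -> is_ideal (loc W) J -> (forall x, x \in g -> J (phi x)) ->
  (forall x, J x -> exists a b, [/\ ispan g a, W b & x = phi a / phi b]) ->
  generated_by (loc W) (map phi g) J.
Proof.
move=> dW iJ gJ Jg; have [W1 WM W0] := dW => x; split=> [/Jg [a [b [[c ->] Wb ->]]]|[c [Rc ->]]].
  exists (fun i => phi (c i) / phi b); split=> [i|]; first by exists (c i), b.
  rewrite size_map rmorph_sum mulr_suml; apply: eq_bigr => i _.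
  by rewrite (nth_map 0) // rmorphM mulrAC.
have [_ [J0 [JD JM]]] := iJ; apply: (big_ind J) => // i _; apply: JM; first exact: Rc.
have ig : (i < size g)%N by have := ltn_ord i; rewrite [X in (_ < X)%N -> _]size_map.
by rewrite (nth_map 0) //; apply: gJ; apply: mem_nth.
Qed.

Lemma noetherian_fractions W : denominators W -> noeth A -> noetherian (loc W).
Proof.
move=> dW nA J iJ; have [g Hg] := nA _ (contract_ideal dW iJ).
exists (map phi g); apply: (generated_fractions dW iJ) => x.
  by move=> xg; apply/Hg; apply: mem_ispan.
move=> Jx; have [JR _] := iJ; have [a [b [_ Wb E]]] := JR _ Jx.
by exists a, b; split=> //; apply/Hg/(is_ideal_numerator a dW iJ Wb); rewrite -E.
Qed.

Section AtPrime.
Variable P : A -> Prop.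
Hypothesis prP : iprime P.
Local Notation V := (fun b => ~ P b).

Lemma denominators_compl : denominators V.
Proof.
case: prP => [[P0 _ _] P1 Pp]; split=> // [b c nb nc /Pp [] //|b nb].
by apply/eqP; rewrite -(rmorph0 phi) => /phi_inj b0; apply: nb; rewrite b0.
Qed.

Lemma prime_ideal_fractions Q :
  iprime Q -> (forall x, Q x -> P x) -> prime_ideal (loc V) (fractions Q V).
Proof.
move=> [iQ Q1 Qp] QP; have dV := denominators_compl; have [V1 VM V0] := dV.
split; [exact: is_ideal_fractions|split].
  move=> [a [b [Qa Vb E]]]; apply: (Vb); apply: QP; suff <- : a = b by [].
  by apply: phi_inj; rewrite -[LHS](divfK (V0 _ Vb)) -E mul1r.
move=> x y [a [b [_ Vb ->]]] [c [d [_ Vd ->]]] [e [g [Qe Vg E]]].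
have /Qp [/Qp [Qa|Qc]|Qg] : Q ((a * c) * g).
- have -> : a * c * g = (b * d) * e.
    apply: phi_inj; rewrite !rmorphM; have -> : phi e = phi a / phi b * (phi c / phi d) * phi g.
      by rewrite E divfK // V0.
    by field; rewrite !V0.
  by case: iQ => _ _; apply.
- by left; exists a, b.
- by right; exists c, d.
- by case: Vg; apply: QP.
Qed.

Lemma iprime_fractions J : prime_ideal (loc V) J -> iprime (fun a => J (phi a)).
Proof.
move=> [iJ [J1 Jp]]; have dV := denominators_compl; have [V1 VM V0] := dV.
split; [exact: contract_ideal dV iJ|by rewrite rmorph1|].
by move=> x y; rewrite rmorphM; apply: Jp; apply: fractions1.
Qed.

End AtPrime.
End Fractions.

(** * Regularity at a prime, and after inverting one element *)

Section RegularLocalization.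
Variables (K : fieldType) (n : nat) (L : fieldType) (phi : {rmorphism T K n -> L}).
Hypothesis phi_inj : injective phi.

(** [prime_structure] gives [d] generators of the maximal ideal and a chain of length [d]; a longer
    chain in the localization contracts to one excluded by [no_longer_chain]. *)
Lemma regular_at_prime (P : T K n -> Prop) : iprime P ->
  regular_local (fractions phi (fun _ => True) (fun b => ~ P b)) (fractions phi P (fun b => ~ P b)).
Proof.
move=> prP; have dV := denominators_compl phi_inj prP; have [V1 VM V0] := dV.
have iM := is_ideal_fractions dV (let: And3 iP _ _ := prP in iP).
split; first exact (noetherian_fractions dV (@noeth_T K n)).
have [d [e [g [Q [y [En sg [gP Pg] [Qp Qs QP] indy]]]]]] := prime_structure prP.
have QsubP i : (i <= d)%N -> forall x, Q i x -> P x.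
  move=> id x; rewrite -QP -(subnKC id).
  have: (i + (d - i) <= d)%N by rewrite subnKC.
  elim: (d - i)%N => [|k IH] ik; first by rewrite addn0.
  by rewrite addnS in ik * => /(IH (ltnW ik)); apply: (Qs _ ik).1.
exists d; split; last first.
  exists (map phi g); split; first by rewrite size_map.
  apply: generated_fractions (dV) (iM) _ _ => x.
    by move/gP => Px; apply: fractions1.
  move=> [a [b [Pa Vb ->]]]; have [c [nc Hc]] := Pg _ Pa.
  exists (c * a), (c * b); split=> //; first exact: VM.
  by rewrite !rmorphM; field; rewrite !V0.
split.
  exists (fun i => fractions phi (Q i) (fun b => ~ P b)); split=> i id.
    exact: (prime_ideal_fractions phi_inj prP) (Qp i id) (QsubP i id).
  have [sub [x [x1 x2]]] := Qs i id; split.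
    by move=> z [a [b [Qa Vb ->]]]; exists a, b; split=> //; apply: sub.
  exists (phi x); split; first exact: fractions1.
  move=> [a [b [Qa Vb E]]]; have [_ _ Qpr] := Qp i (ltnW id).
  have : Q i (x * b).
    suff -> : x * b = a by [].
    by apply: phi_inj; rewrite rmorphM E divfK // V0.
  by case/Qpr => // /(QsubP i (ltnW id)).
move=> [J [Jp Js]].
apply: (@no_longer_chain K n P d e y (fun i a => J i (phi a))) => // [i id|i id|x Jx].
- exact: iprime_fractions prP _ (Jp i id).
- have [sub [x [x1 x2]]] := Js i id; split=> [z|]; first exact: sub.
  have [iJ _] := Jp i.+1 id; have [iJ' _] := Jp i (ltnW id).
  have [a [b [_ Vb E]]] := iJ.1 _ x1; exists a; split.
    by apply/(is_ideal_numerator a dV iJ Vb); rewrite -E.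
  by move=> Ja; apply: x2; rewrite E; apply/(is_ideal_numerator a dV iJ' Vb).
(* An element outside [P] is a unit of the local ring, so no proper ideal contains it. *)
- apply: NNPP => nP; have [iJ [J1 _]] := Jp d.+1 (leqnn _); apply: J1.
  rewrite -(mulfV (V0 _ nP)); exact/(is_ideal_numerator x dV iJ nP).
Qed.

(** Localizing twice: a prime of the ring with [f] inverted contracts to a prime [P] of [T K n]
    avoiding the powers of [f], and both local rings are the same subset of [L]. *)
Lemma regular_ring_image (S : L -> Prop) (f : T K n) :
  (forall x, S x <-> exists a, x = phi a) -> f != 0 -> regular_ring (invert S (phi f)).
Proof.
move=> HS f0; pose W b := exists k, b = f ^+ k.
have dW : denominators phi W.
  split=> [|b c [k ->] [l ->]|b [k ->]]; first by exists 0%N.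
    by exists (k + l)%N; rewrite exprD.
  by rewrite rmorphXn expf_neq0 // -(rmorph0 phi) (inj_eq phi_inj).
have -> : invert S (phi f) = fractions phi (fun _ => True) W.
  apply: functional_extensionality => x; apply: propositional_extensionality; split.
    by move=> [z [k [/HS [a ->] ->]]]; exists a, (f ^+ k); split=> //; [exists k|rewrite rmorphXn].
  move=> [a [b [_ [k ->] ->]]]; exists (phi a), k; split; last by rewrite rmorphXn.
  by apply/HS; exists a.
split; first exact (noetherian_fractions dW (@noeth_T K n)).
move=> P' [iP' [P'1 P'p]]; pose P a := P' (phi a); have [W1 WM W0] := dW.
have prP : iprime P.
  split; [exact: contract_ideal dW iP'|by rewrite /P rmorph1|].
  by move=> x y; rewrite /P rmorphM; apply: P'p; apply: fractions1.
have WP b : W b -> ~ P b.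
  move=> Wb Pb; apply: P'1; rewrite -(mulfV (W0 _ Wb)).
  exact/(is_ideal_numerator b dW iP' Wb).
have [V1 VM V0] := denominators_compl phi_inj prP.
have frac_frac a b c d : W b -> W d -> ~ P' (phi c / phi d) ->
    ~ P (b * c) /\ phi a / phi b / (phi c / phi d) = phi (a * d) / phi (b * c).
  move=> Wb Wd nc; have nPc : ~ P c by move=> Pc; apply/nc/(is_ideal_numerator c dW iP' Wd).
  split; first by apply: VM => //; apply: WP.
  by rewrite !rmorphM; field; rewrite (W0 _ Wb) (W0 _ Wd) (V0 _ nPc).
have -> : localization (fractions phi (fun _ => True) W) P' =
    fractions phi (fun _ => True) (fun b => ~ P b).
  apply: functional_extensionality => x; apply: propositional_extensionality; split.
    move=> [u [v [[a [b [_ Wb ->]]] [[c [d [_ Wd ->]]] [nc ->]]]]].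
    have [nP ->] := frac_frac a b c d Wb Wd nc.
    by exists (a * d), (b * c).
  by move=> [a [b [_ nb ->]]]; exists (phi a), (phi b); do !split=> //; apply: fractions1.
have -> : loc_maximal (fractions phi (fun _ => True) W) P' = fractions phi P (fun b => ~ P b).
  apply: functional_extensionality => x; apply: propositional_extensionality; split.
    move=> [u [v [Pu [[c [d [_ Wd ->]]] [nc ->]]]]]; have [a [b [_ Wb E]]] := iP'.1 _ Pu.
    rewrite E in Pu *; have [nP ->] := frac_frac a b c d Wb Wd nc.
    exists (a * d), (b * c); split=> //; have [[_ _ PM] _ _] := prP.
    by rewrite mulrC; apply: PM; apply/(is_ideal_numerator a dW iP' Wb).
  by move=> [a [b [Pa nb ->]]]; exists (phi a), (phi b); do !split=> //; apply: fractions1.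
exact: regular_at_prime.
Qed.

End RegularLocalization.

(** * Coordinates on matrices *)

Lemma det_schur (F : fieldType) r c (A : 'M[F]_r) (B : 'M[F]_(r, c)) (C : 'M[F]_(c, r)) (D : 'M[F]_c) :
  A \in unitmx -> \det (block_mx A B C D) = \det A * \det (D - C *m invmx A *m B).
Proof.
move=> uA.
have -> : block_mx A B C D =
    block_mx 1%:M 0 (C *m invmx A) 1%:M *m block_mx A B 0 (D - C *m invmx A *m B).
  by rewrite mulmx_block !mul1mx !mul0mx !addr0 mulmxKV // addrC subrK.
by rewrite det_mulmx det_lblock !det1 !mul1r det_ublock.
Qed.

(** The block inversion formula multiplied by [\det Y], verified by multiplying both sides by the
    unit [Y]. *)
Lemma adj_bordered (F : fieldType) r (U : 'M[F]_r) (v : 'M[F]_(r, 1)) (w : 'M[F]_(1, r))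
    (z : 'M[F]_1) (s := (z - w *m invmx U *m v) 0 0) (Y := block_mx U v w z) :
  U \in unitmx -> s != 0 ->
  \det Y = \det U * s /\
  \adj Y = \det U *: block_mx (s *: invmx U + invmx U *m v *m (w *m invmx U))
                              (- (invmx U *m v)) (- (w *m invmx U)) 1%:M.
Proof.
move=> uU s0; have detY : \det Y = \det U * s by rewrite det_schur // det_mx11.
split=> //; have dU : \det U != 0 by rewrite -unitfE -unitmxE.
have uY : Y \in unitmx by rewrite unitmxE detY unitfE mulf_neq0.
apply: (can_inj (mulmxK uY)); rewrite mul_adj_mx detY -scalemxAl mulmx_block.
have Es : w *m invmx U *m v = z - s%:M.
  by rewrite /s -mx11_scalar opprB addrC subrK.
rewrite -scale_scalar_mx; congr (_ *: _); rewrite scalar_mx_block; congr block_mx.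
- by rewrite mulmxDl -scalemxAl mulVmx // mulNmx -(mulmxA _ _ U) mulmxKV // addrK scalemx1.
- rewrite mulmxDl -scalemxAl mulNmx -(mulmxA _ (w *m invmx U)) Es mulmxBr mul_mx_scalar.
  by rewrite addrCA subrr addr0 subrr.
- by rewrite mulNmx mulmxKV // mul1mx addNr.
- by rewrite mulNmx mul1mx Es opprB subrK.
Qed.

Section Coordinates.
Variables (F : fieldType) (s p q : nat).
Local Notation t := s.+1.

Section Mat.
Variable X : 'M[F]_(t + p.+1, t + q.+1).

(** In the letters of the introductory comment, [topleft], [lowfac], [upfac], [schur], [pivot],
    [scinv] and [nschur] are U, a, b, S, sigma, N and S'. *)
Definition topleft : 'M[F]_t := ulsubmx X.
Definition lowfac : 'M[F]_(p.+1, t) := dlsubmx X *m invmx topleft.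
Definition upfac : 'M[F]_(t, q.+1) := invmx topleft *m ursubmx X.
Definition schur : 'M[F]_(p.+1, q.+1) := drsubmx X - lowfac *m ursubmx X.
Definition pivot : F := schur 0 0.
Definition scinv : 'M[F]_t := pivot *: invmx topleft.
Definition nschur : 'M[F]_(p.+1, q.+1) := pivot^-1 *: schur.

Definition set00 (c : F) (A : 'M[F]_(p.+1, q.+1)) : 'M[F]_(p.+1, q.+1) :=
  \matrix_(k, l) if (k == 0) && (l == 0) then c else A k l.

(* [nschur] always has [1] at [(0, 0)], so this entry is replaced by the determinant of [topleft]. *)
Definition coords : 'M[F]_(t + p.+1, t + q.+1) :=
  block_mx scinv upfac lowfac (set00 (\det topleft) nschur).

Hypotheses (uU : topleft \in unitmx) (s0 : pivot != 0).

Lemma det_topleft_neq0 : \det topleft != 0.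
Proof. by rewrite -unitfE -unitmxE. Qed.

Lemma det_scinv : \det scinv = pivot ^+ t / \det topleft.
Proof. by rewrite detZ det_inv. Qed.

Lemma scinv_unit : scinv \in unitmx.
Proof. by rewrite unitmxE det_scinv unitfE mulf_neq0 ?expf_neq0 ?invr_eq0 ?det_topleft_neq0. Qed.

Lemma invmx_scinv : invmx scinv = pivot^-1 *: topleft.
Proof.
apply: (can_inj (mulKmx scinv_unit)); rewrite mulmxV ?scinv_unit //.
by rewrite /scinv -scalemxAl -scalemxAr scalerA mulfV // scale1r mulVmx.
Qed.

(** The block factorization of X through U, with U = sigma N^-1 and S = sigma S'. *)
Lemma coords_factorization :
  X = pivot *: (col_mx 1%:M lowfac *m invmx scinv *m row_mx 1%:M upfac + block_mx 0 0 0 nschur).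
Proof.
rewrite invmx_scinv mul_col_mx mul1mx mul_col_row !mulmx1 -scalemxAr -!scalemxAl.
rewrite add_block_mx !addr0 scale_block_mx scalerDr /nschur !scalerA mulfV // !scale1r.
rewrite -[LHS]submxK; congr block_mx.
- by rewrite /upfac mulKVmx.
- by rewrite /lowfac mulmxKV.
- by rewrite /schur /lowfac /upfac mulmxKV // -mulmxA addrC subrK.
Qed.

(* The Schur complement of [- scinv] in the [2t x 2t] matrix below is the submatrix, up to the
   factor [pivot]. *)
Lemma minor_coords (f : 'I_t -> 'I_(t + p.+1)) (g : 'I_t -> 'I_(t + q.+1)) :
  \det (mxsub f g X) = (-1) ^+ t * \det topleft *
    \det (block_mx (- scinv) (colsub g (row_mx 1%:M upfac)) (rowsub f (col_mx 1%:M lowfac))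
                   (mxsub f g (block_mx 0 0 0 nschur))).
Proof.
have E0 : - scinv = (-1) *: scinv by rewrite scaleN1r.
have uN : - scinv \in unitmx.
  by rewrite unitmxE E0 detZ unitrM unitrX ?unitrN1 // -unitmxE scinv_unit.
rewrite det_schur // {1}coords_factorization.
have -> : invmx (- scinv) = - invmx scinv.
  apply: (can_inj (mulKmx uN)); rewrite mulmxV // mulNmx mulmxN opprK mulmxV //.
  exact: scinv_unit.
rewrite mulmxN mulNmx opprK E0 detZ det_scinv [_ + _ *m _]addrC.
have -> : rowsub f (col_mx 1%:M lowfac) *m invmx scinv *m colsub g (row_mx 1%:M upfac) =
    mxsub f g (col_mx 1%:M lowfac *m invmx scinv *m row_mx 1%:M upfac).
  rewrite mxsub_mul; congr (_ *m _); apply/matrixP => i j; rewrite !mxE.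
  by apply: eq_bigr => k _; rewrite !mxE.
rewrite -[in RHS](raddfD (mxsub f g)) /= linearZ /= detZ mulrA; congr (_ * _).
rewrite mulrACA -exprMn mulrNN mulr1 expr1n mul1r mulrC divfK //.
exact: det_topleft_neq0.
Qed.

End Mat.

(** With [c] as the pivot, U must be c N^-1, of determinant c^t / det N. This has to be the
    prescribed entry [S 0 0], hence the equation on [c]. *)
Lemma coords_surj (N : 'M[F]_t) (b : 'M[F]_(t, q.+1)) (a : 'M[F]_(p.+1, t))
    (S : 'M[F]_(p.+1, q.+1)) (c : F) :
  N \in unitmx -> S 0 0 != 0 -> c ^+ t = \det N * S 0 0 ->
  exists X, [/\ topleft X \in unitmx, pivot X != 0 & coords X = block_mx N b a S].
Proof.
move=> uN S0 Ec; have c0 : c != 0.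
  have : c ^+ t != 0 by rewrite Ec mulf_neq0 // -unitfE -unitmxE.
  by rewrite expf_eq0.
pose U := c *: invmx N; have uU : U \in unitmx.
  by rewrite unitmxE detZ unitrM unitrX ?unitfE // -unitfE -unitmxE unitmx_inv.
have iU : invmx U = c^-1 *: N.
  apply: (can_inj (mulKmx uU)); rewrite mulmxV // /U -scalemxAl -scalemxAr scalerA mulfV //.
  by rewrite scale1r mulVmx.
exists (block_mx U (U *m b) (a *m U) (c *: set00 1 S + a *m U *m b)).
have Etl : topleft (block_mx U (U *m b) (a *m U) (c *: set00 1 S + a *m U *m b)) = U.
  by rewrite /topleft block_mxKul.
set X := block_mx _ _ _ _ in Etl *.
have Elow : lowfac X = a by rewrite /lowfac Etl block_mxKdl mulmxK.
have Eup : upfac X = b by rewrite /upfac Etl block_mxKur mulKmx.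
have Esc : schur X = c *: set00 1 S.
  by rewrite /schur Elow block_mxKdr block_mxKur mulmxA addrK.
have Epv : pivot X = c by rewrite /pivot Esc !mxE /= mulr1.
split; rewrite ?Etl ?Epv //; rewrite /coords /scinv /nschur Etl Elow Eup Esc Epv iU.
rewrite !scalerA mulfV // mulVf // !scale1r; congr block_mx.
apply/matrixP => k l; rewrite !mxE; case: ifP => [/andP[/eqP -> /eqP ->]|->//].
rewrite detZ det_inv Ec mulrAC mulfV ?mul1r //.
by rewrite -unitfE -unitmxE.
Qed.

End Coordinates.

(** * Algebraic independence of the coordinates *)

Section Specialization.
Variables (A : idomainType) (L K : fieldType) (phi : {rmorphism A -> L}) (e : {rmorphism A -> K}).
Hypothesis phi_inj : injective phi.

(* Graph of the extension of [e] to the local ring of fractions whose denominator is not killed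
   by [e]. *)
Definition specializes (z : L) (c : K) : Prop :=
  exists a b, [/\ e b != 0, z = phi a / phi b & e a = c * e b].

Lemma phi_neq0 b : e b != 0 -> phi b != 0.
Proof. by apply: contraNneq => /eqP; rewrite -(rmorph0 phi) (inj_eq phi_inj) => /eqP ->; rewrite rmorph0. Qed.

Lemma specializes_phi a : specializes (phi a) (e a).
Proof. by exists a, 1; rewrite !rmorph1 oner_neq0 mulr1 divr1. Qed.

Lemma specializes0 : specializes 0 0.
Proof. by have := specializes_phi 0; rewrite !rmorph0. Qed.

Lemma specializes1 : specializes 1 1.
Proof. by have := specializes_phi 1; rewrite !rmorph1. Qed.

Lemma specializesD z c z' c' : specializes z c -> specializes z' c' -> specializes (z + z') (c + c').
Proof.
move=> [a [b [b0 -> Ea]]] [a' [b' [b'0 -> Ea']]]; exists (a * b' + a' * b), (b * b').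
rewrite !rmorphM mulf_neq0 //; split=> //; last by rewrite rmorphD !rmorphM Ea Ea'; ring.
by rewrite rmorphD !rmorphM; field; rewrite !phi_neq0.
Qed.

Lemma specializesM z c z' c' : specializes z c -> specializes z' c' -> specializes (z * z') (c * c').
Proof.
move=> [a [b [b0 -> Ea]]] [a' [b' [b'0 -> Ea']]]; exists (a * a'), (b * b').
rewrite !rmorphM mulf_neq0 //; split=> //; last by rewrite Ea Ea'; ring.
by field; rewrite !phi_neq0.
Qed.

Lemma specializesN z c : specializes z c -> specializes (- z) (- c).
Proof.
have := specializes_phi (-1); rewrite !rmorphN1 -[- z]mulN1r -[- c]mulN1r.
exact: specializesM.
Qed.

Lemma specializesV z c : c != 0 -> specializes z c -> specializes z^-1 c^-1.
Proof.
move=> c0 [a [b [b0 -> Ea]]]; exists b, a; rewrite Ea mulf_neq0 // mulKf //; split=> //.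
by rewrite invf_div.
Qed.

Lemma specializes0_eq c : specializes 0 c -> c = 0.
Proof.
move=> [a [b [b0 /esym/eqP]]]; rewrite mulf_eq0 invr_eq0 (negPf (phi_neq0 b0)) orbF.
rewrite -(rmorph0 phi) (inj_eq phi_inj) => /eqP ->; rewrite rmorph0 => /esym/eqP.
by rewrite mulf_eq0 (negPf b0) orbF => /eqP.
Qed.

Lemma specializes_neq0 z c : c != 0 -> specializes z c -> z != 0.
Proof. by move=> c0 Hz; apply: contra_neqN c0 => /eqP z0; apply: specializes0_eq; rewrite -z0. Qed.

Lemma specializes_sum I (r : seq I) (f : I -> L) (g : I -> K) :
  (forall i, specializes (f i) (g i)) -> specializes (\sum_(i <- r) f i) (\sum_(i <- r) g i).
Proof. by move=> H; apply: big_ind2 => //; [exact: specializes0|move=> *; apply: specializesD]. Qed.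

Lemma specializes_prod I (r : seq I) (f : I -> L) (g : I -> K) :
  (forall i, specializes (f i) (g i)) -> specializes (\prod_(i <- r) f i) (\prod_(i <- r) g i).
Proof. by move=> H; apply: big_ind2 => //; [exact: specializes1|move=> *; apply: specializesM]. Qed.

Definition specializes_mx r1 r2 (Z : 'M[L]_(r1, r2)) (C : 'M[K]_(r1, r2)) : Prop :=
  forall i j, specializes (Z i j) (C i j).

Lemma specializes_mulmx r1 r2 r3 (Z : 'M_(r1, r2)) C (Z' : 'M_(r2, r3)) C' :
  specializes_mx Z C -> specializes_mx Z' C' -> specializes_mx (Z *m Z') (C *m C').
Proof. by move=> H H' i j; rewrite !mxE; apply: specializes_sum => k; apply: specializesM. Qed.

Lemma specializes_subr_mx r1 r2 (Z Z' : 'M_(r1, r2)) C C' :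
  specializes_mx Z C -> specializes_mx Z' C' -> specializes_mx (Z - Z') (C - C').
Proof. by move=> H H' i j; rewrite !mxE; apply: specializesD => //; apply: specializesN. Qed.

Lemma specializes_scale_mx r1 r2 z c (Z : 'M_(r1, r2)) C :
  specializes z c -> specializes_mx Z C -> specializes_mx (z *: Z) (c *: C).
Proof. by move=> H H' i j; rewrite !mxE; apply: specializesM. Qed.

Lemma specializes_det r (Z : 'M_r) C : specializes_mx Z C -> specializes (\det Z) (\det C).
Proof.
move=> H; apply: specializes_sum => u; apply: specializesM; last exact: specializes_prod.
by rewrite -(rmorph_sign phi) -(rmorph_sign e); apply: specializes_phi.
Qed.

Lemma specializes_invmx r (Z : 'M_r) C :
  C \in unitmx -> specializes_mx Z C -> specializes_mx (invmx Z) (invmx C).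
Proof.
move=> uC H; have d0 : \det C != 0 by rewrite -unitfE -unitmxE.
have uZ : Z \in unitmx.
  by rewrite unitmxE unitfE (specializes_neq0 d0) //; apply: specializes_det.
move=> i j; rewrite /invmx uZ uC !mxE; apply: specializesM.
  by apply: specializesV => //; apply: specializes_det.
apply: specializesM.
  by rewrite -(rmorphN1 phi) -(rmorphN1 e) -!rmorphXn; apply: specializes_phi.
by apply: specializes_det => k l; rewrite !mxE.
Qed.

Lemma specializes_coords s p q (Z : 'M_(s.+1 + p.+1, s.+1 + q.+1)) C :
  topleft C \in unitmx -> pivot C != 0 ->
  specializes_mx Z C -> specializes_mx (coords Z) (coords C).
Proof.
move=> uC p0 H.
have Hul : specializes_mx (topleft Z) (topleft C) by move=> i j; rewrite /topleft !mxE.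
have Hinv := specializes_invmx uC Hul.
have Hur : specializes_mx (ursubmx Z) (ursubmx C) by move=> i j; rewrite !mxE.
have Hlow : specializes_mx (lowfac Z) (lowfac C).
  by apply: specializes_mulmx => // i j; rewrite !mxE.
have Hsch : specializes_mx (schur Z) (schur C).
  by apply: specializes_subr_mx; [move=> i j; rewrite !mxE|apply: specializes_mulmx].
have Hpiv : specializes (pivot Z) (pivot C) := Hsch 0 0.
move=> i j; rewrite /coords; case: (split_ordP i) => i' ->; case: (split_ordP j) => j' ->.
- by rewrite !block_mxEul; apply: specializes_scale_mx.
- by rewrite !block_mxEur; apply: specializes_mulmx.
- by rewrite !block_mxEdl.
- rewrite !block_mxEdr ![set00 _ _ i' j']mxE; case: ifP => _; first exact: specializes_det.
  by apply: specializes_scale_mx => //; apply: specializesV.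
Qed.

Lemma specializes_ev (iotaL : {rmorphism K -> L}) r (y : nat -> L) (c : nat -> K) (f : T K r) :
  (forall a, specializes (iotaL a) a) -> (forall i, specializes (y i) (c i)) ->
  specializes (ev iotaL y r f) (ev idfun c r f).
Proof.
move=> Hi Hy; elim: r f => [|r IH] f; first exact: Hi.
elim/poly_ind: f => [|f a IHf]; first by rewrite !rmorph0; apply: specializes0.
rewrite !evS !rmorphD !rmorphM /= !map_polyX !map_polyC !hornerD !hornerM !hornerX !hornerC.
apply: specializesD; last exact: IH.
by apply: specializesM.
Qed.

End Specialization.

(** * Variables of the iterated polynomial ring and points where a polynomial does not vanish *)

Section FormalVariables.
Variable K : fieldType.

Fixpoint var n (i : nat) : T K n :=
  match n with
  | 0 => 0
  | k.+1 => if i == k then ('X : {poly T K k}) else (var k i)%:P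
  end.

Lemma ev_var (R : comNzRingType) (iota : {rmorphism K -> R}) y n i :
  (i < n)%N -> ev iota y n (var n i) = y i.
Proof.
elim: n => // n IH; rewrite ltnS leq_eqVlt evS /=.
case: eqP => [-> _|_ /=]; first by rewrite map_polyX hornerX.
by move/IH => E; rewrite map_polyC hornerC; apply: E.
Qed.

(** The entries in the order of [mxvec], extended by 0 to all naturals, the form in which [ev] takes
    its values. *)
Definition entries (R : nmodType) r1 r2 (M : 'M[R]_(r1, r2)) (k : nat) : R :=
  if insub k is Some i then mxvec M 0 i else 0.

Lemma entriesE (R : nmodType) r1 r2 (M : 'M[R]_(r1, r2)) i j : entries M (mxvec_index i j) = M i j.
Proof. by rewrite /entries valK mxvecE. Qed.

(** The first variables are chosen so that the leading coefficient survives, then the last one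
    avoids the zeros of what remains. *)
Lemma ev_nonvanishing (Kinf : forall p : {poly K}, p != 0 -> exists c, p.[c] != 0) n (f : T K n) :
  f != 0 -> exists c, ev idfun c n f != 0.
Proof.
elim: n f => [|n IH] f f0; first by exists (fun _ => 0).
have l0 : lead_coef (f : {poly T K n}) != 0 by rewrite lead_coef_eq0.
have [c Hc] := IH _ l0.
have [|x Hx] := Kinf (map_poly (ev idfun c n) (f : {poly T K n})).
  apply: contraNneq Hc => E; have := congr1 (fun g : {poly K} => g`_(size (f : {poly T K n})).-1) E.
  by rewrite coef_map coef0 => E'; apply/eqP.
exists (fun i => if (i < n)%N then c i else x); rewrite evS ltnn.
rewrite (@eq_map_poly _ _ _ (ev idfun c n)) //.
by apply: eq_ev => // i ->.
Qed.

End FormalVariables.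

Section Independence.
Variables (K : closedFieldType) (s p q : nat).
Local Notation t := s.+1.
Local Notation m := (t + p.+1)%N.
Local Notation n := (t + q.+1)%N.
Local Notation P := {mpoly K[m * n]}.
Local Notation L := {fraction P}.

Definition iotaL : {rmorphism K -> L} :=
  (@FracField.tofrac P \o @mpolyC (m * n) K)%FUN.

Definition generic_mx : 'M[L]_(m, n) := \matrix_(i, j) FracField.tofrac 'X_(mxvec_index i j).

Lemma tofrac_inj : injective (@FracField.tofrac P).
Proof. by move=> a b /eqP; rewrite tofrac_eq => /eqP. Qed.

Lemma generic_mx_specializes (C : 'M[K]_(m, n)) :
  specializes_mx (@FracField.tofrac P) (meval (fun k => mxvec C 0 k)) generic_mx C.
Proof.
move=> i j; rewrite mxE -[C i j]mxvecE -(mevalXU (fun k => mxvec C 0 k)).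
exact: specializes_phi.
Qed.

Lemma closed_nonvanishing (f : {poly K}) : f != 0 -> exists c, f.[c] != 0.
Proof. by move/closed_nonrootP => [c]; exists c. Qed.

(** A relation [f] between the coordinates specializes to every point realized by [coords_surj],
    that is, wherever [G] below is nonzero. Hence [G * f] vanishes everywhere, although both factors
    are nonzero. *)
Lemma coords_indep : injective (ev iotaL (entries (coords generic_mx)) (m * n)).
Proof.
apply: raddf_inj => f Ef; apply/eqP/negPn/negP => f0.
pose V : 'M[T K (m * n)]_(m, n) := \matrix_(i, j) var K (m * n) (mxvec_index i j).
pose G := \det (ulsubmx V) * drsubmx V 0 0.
pose mxof (c : nat -> K) : 'M[K]_(m, n) := \matrix_(i, j) c (mxvec_index i j).
have EV c : ev idfun c (m * n) G = \det (ulsubmx (mxof c)) * drsubmx (mxof c) 0 0.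
  apply: etrans (rmorphM (ev idfun c (m * n)) _ _) _; congr (_ * _); last by rewrite !mxE ev_var.
  by rewrite -det_map_mx; congr (\det _); apply/matrixP => i j; rewrite !mxE ev_var.
have G0 : G != 0.
  (* A point at which [G] takes the value 1. *)
  pose C0 : 'M[K]_(m, n) := block_mx 1%:M 0 0 (const_mx 1).
  have := EV (entries C0).
  have -> : mxof (entries C0) = C0 by apply/matrixP => i j; rewrite mxE entriesE.
  rewrite block_mxKul block_mxKdr det1 mxE mul1r => E.
  by apply: contra_eq_neq E => ->; rewrite rmorph0 eq_sym oner_neq0.
have [|c] := ev_nonvanishing closed_nonvanishing (f := G * f); first by rewrite mulf_neq0.
pose C := mxof c; rewrite (rmorphM (ev idfun c (m * n))) EV -/C !mulf_eq0 !negb_or -andbA => /and3P[N0 S0 Hf].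
(* The t-th root exists because [K] is algebraically closed; it becomes the pivot. *)
have [z Hz] : exists z : K, z ^+ t = \det (ulsubmx C) * drsubmx C 0 0.
  have : size ('X^t - (\det (ulsubmx C) * drsubmx C 0 0)%:P) != 1%N by rewrite size_XnsubC.
  case/closed_rootP => z; rewrite rootE !hornerE subr_eq0 => /eqP Ez; by exists z.
have uN : ulsubmx C \in unitmx by rewrite unitmxE unitfE.
have [X0 [uX pX EX]] := coords_surj (ursubmx C) (dlsubmx C) uN S0 Hz.
have Hsp := specializes_coords tofrac_inj uX pX (generic_mx_specializes X0).
rewrite EX submxK in Hsp.
have /(specializes0_eq tofrac_inj) E : specializes (@FracField.tofrac P)
    (meval (fun k => mxvec X0 0 k)) 0 (ev idfun (entries C) (m * n) f).
  rewrite -Ef; apply: specializes_ev; first exact: tofrac_inj.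
    by move=> a; rewrite -{2}[a](mevalC (fun k => mxvec X0 0 k)); apply: specializes_phi.
  move=> k; rewrite /entries; case: insubP => [k' _ _|_]; last exact: specializes0.
  by case/mxvec_indexP: k' => i j; rewrite !mxvecE.
case/eqP: Hf; rewrite -E; apply: eq_ev => // k kmn.
have -> : k = Ordinal kmn :> nat by [].
by case/mxvec_indexP: (Ordinal kmn) => i j; rewrite entriesE mxE.
Qed.

End Independence.

(** * Minors of the generic matrix *)

Section GenericMinors.
Variables (K : fieldType) (m n : nat).
Local Notation P := {mpoly K[m * n]}.

Lemma XeE (i : 'I_m) (j : 'I_n) : Xe K m n i j = 'X_(mxvec_index i j).
Proof. by rewrite /Xe !valK. Qed.

Definition gen_minor r (f : 'I_r -> 'I_m) (g : 'I_r -> 'I_n) : P :=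
  \det (\matrix_(k < r, l < r) Xe K m n (f k) (g l)).

(** For injective [f] and [g], the partial permutation matrix matching row [f k] with column [g k];
    evaluating minors at it separates their index sets. *)
Definition pairing r (f : 'I_r -> 'I_m) (g : 'I_r -> 'I_n) : 'M[K]_(m, n) :=
  \matrix_(i, j) [exists k, (f k == i) && (g k == j)]%:R.

Lemma meval_gen_minor r r' (f : 'I_r -> 'I_m) (g : 'I_r -> 'I_n)
    (f' : 'I_r' -> 'I_m) (g' : 'I_r' -> 'I_n) :
  (gen_minor f' g').@[fun k => mxvec (pairing f g) 0 k] = \det (mxsub f' g' (pairing f g)).
Proof.
rewrite /gen_minor -det_map_mx; congr (\det _); apply/matrixP => i j.
rewrite 3!mxE XeE; apply: etrans (mevalXU _ _) _; by rewrite mxvecE mxE.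
Qed.

Lemma det_pairing r (f : 'I_r -> 'I_m) (g : 'I_r -> 'I_n) :
  injective f -> injective g -> \det (mxsub f g (pairing f g)) = 1.
Proof.
move=> fi gi; rewrite -(det1 K r); congr (\det _); apply/matrixP => i j; rewrite !mxE.
congr (nat_of_bool _)%:R; apply/existsP/eqP => [[k /andP[/eqP/fi -> /eqP/gi ->]] //|->].
by exists j; rewrite !eqxx.
Qed.

Lemma gen_minor_neq0 r (f : 'I_r -> 'I_m) (g : 'I_r -> 'I_n) :
  injective f -> injective g -> gen_minor f g != 0.
Proof.
move=> fi gi; apply/eqP => E; have := meval_gen_minor f g f g.
by rewrite det_pairing // E meval0 => /eqP; rewrite eq_sym oner_eq0.
Qed.

(** At [pairing f g] the first minor is 1. An index of [f'] or [g'] outside those of [f] or [g]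
    would give the second one a zero row or column. *)
Lemma gen_minor_eq r (f f' : 'I_r -> 'I_m) (g g' : 'I_r -> 'I_n) :
  injective f -> injective g -> gen_minor f g = gen_minor f' g' ->
  (forall k, exists l, f' k = f l) /\ (forall k, exists l, g' k = g l).
Proof.
move=> fi gi E; have := meval_gen_minor f g f g.
rewrite det_pairing // E meval_gen_minor => d1.
have d0 : \det (mxsub f' g' (pairing f g)) != 0 by rewrite d1 oner_neq0.
split=> k; apply: NNPP => H; case/eqP: d0.
- rewrite (expand_det_row _ k) big1 // => j _; rewrite !mxE.
  case: existsP => [[l /andP[/eqP fl _]]|_]; last by rewrite mul0r.
  by case: H; exists l.
- rewrite (expand_det_col _ k) big1 // => j _; rewrite !mxE.
  case: existsP => [[l /andP[_ /eqP gl]]|_]; last by rewrite mul0r.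
  by case: H; exists l.
Qed.

End GenericMinors.

(** * Increasing tuples as index sets *)

Section IncreasingTuples.
Variables (t k : nat).
Implicit Types a : t.-tuple 'I_k.

Lemma inc_tuplesP a :
  reflect (forall i j : 'I_t, (i < j)%N -> (tnth a i < tnth a j)%N) (a \in inc_tuples t k).
Proof.
rewrite mem_filter mem_enum andbT.
have E (i : 'I_t) : nth 0%N [seq val x | x <- a] i = tnth a i.
  by rewrite (nth_map (tnth a i)) ?size_tuple // -tnth_nth.
apply: (iffP idP) => [H i j ij|H].
  rewrite -!E; apply: (sorted_ltn_nth ltn_trans) => //; by rewrite inE size_map size_tuple.
apply/(sortedP 0%N) => i; rewrite size_map size_tuple => it.
have it' := ltnW it.
by rewrite (E (Ordinal it)) (E (Ordinal it')); apply: H.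
Qed.

Lemma inc_tuple_inj a : a \in inc_tuples t k -> injective (tnth a).
Proof.
move/inc_tuplesP => H i j E; apply/val_inj/eqP.
by case: ltngtP => // /H; rewrite E ltnn.
Qed.

Lemma inc_tuple_eq a a' : a \in inc_tuples t k -> a' \in inc_tuples t k ->
  (forall i, exists j, tnth a' i = tnth a j) -> a = a'.
Proof.
move=> ia ia' H; apply/val_inj/(inj_map val_inj).
have sa : sorted ltn [seq val x | x <- a] by move: ia; rewrite mem_filter => /andP[].
have sa' : sorted ltn [seq val x | x <- a'] by move: ia'; rewrite mem_filter => /andP[].
apply: (irr_sorted_eq ltn_trans ltnn sa sa').
have ua : uniq a by apply/(tuple_uniqP a)/inc_tuple_inj.
have ua' : uniq a' by apply/(tuple_uniqP a')/inc_tuple_inj.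
apply: eq_mem_map => x; apply/esym; apply: (uniq_min_size _ _ _).2; rewrite ?size_tuple //.
by move=> _ /tnthP[i ->]; have [j ->] := H i; apply: mem_tnth.
Qed.

Lemma idxS a (i : 'I_t) : idx a i.+1 = (tnth a i).+1.
Proof.
by rewrite /= (nth_map (tnth a i)) ?size_tuple // -tnth_nth.
Qed.

End IncreasingTuples.

Lemma minor_inj (K : fieldType) (m n t : nat) (a a' : t.-tuple 'I_m) (b b' : t.-tuple 'I_n) :
  a \in inc_tuples t m -> a' \in inc_tuples t m -> b \in inc_tuples t n -> b' \in inc_tuples t n ->
  minor K a b = minor K a' b' -> a = a' /\ b = b'.
Proof.
move=> ia ia' ib ib' E; have [ea eb] := gen_minor_eq (inc_tuple_inj ia) (inc_tuple_inj ib) E.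
by split; apply: inc_tuple_eq.
Qed.

Lemma bump_ord r (i : 'I_r) : bump r i = i.
Proof. by rewrite /bump leqNgt ltn_ord. Qed.

(** * Index tuples of the t-minors inside a bordered minor *)

Section OneRowReplaced.
Variables (s p : nat).
Local Notation t := s.+1.

(** The indices 0, ..., s followed by the border index t + k, which every [u] from [t] on yields. *)
Definition bord (k : 'I_p.+1) (u : nat) : 'I_(t + p.+1) :=
  if insub u is Some v then lshift p.+1 (v : 'I_t) else rshift t k.

Lemma val_bord k u : bord k u = (if u < t then u else t + k)%N :> nat.
Proof. by rewrite /bord; case: insubP => [v -> /= ->|/negPf ->]. Qed.

(* The rows [0, ..., s, t + k] with the [j]-th one omitted. *)
Definition omit (k : 'I_p.+1) (j : nat) : t.-tuple 'I_(t + p.+1) :=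
  [tuple bord k (bump j i) | i < t].

Lemma val_omit k j (i : 'I_t) :
  tnth (omit k j) i = (if bump j i < t then bump j i else t + k)%N :> nat.
Proof. by rewrite tnth_mktuple val_bord. Qed.

Lemma omit_inc k j : omit k j \in inc_tuples t (t + p.+1).
Proof.
apply/inc_tuplesP => i i' lti; have := ltn_ord i; have := ltn_ord i'; move=> it' it.
rewrite !val_omit /bump; case: (leqP j i) => ji; case: (leqP j i') => ji'; rewrite ?add0n ?add1n.
all: by repeat case: ifP => ?; lia.
Qed.

(** For j = t the border index itself is left out, so [k] can be recovered only when j < t. *)
Lemma omit_inj k k' j j' : (j <= t)%N -> (j' <= t)%N -> omit k j = omit k' j' ->
  j = j' /\ ((j < t)%N -> k = k').
Proof.
(* At position [j1] the first tuple has already jumped past [j1], the second has not. *)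
have aux k1 k2 j1 j2 : (j1 < j2)%N -> (j2 <= t)%N -> omit k1 j1 <> omit k2 j2.
  move=> lt12 le2t E; have lt1t : (j1 < t)%N by lia.
  have := congr1 (fun a => val (tnth a (Ordinal lt1t))) E; rewrite /= !val_omit /= /bump.
  by rewrite leqnn (leqNgt j2) lt12 add0n add1n; repeat case: ifP => ?; lia.
move=> jt j't E; case: (ltngtP j j') => [lt|gt|ej].
- by case: (aux _ _ _ _ lt j't E).
- by case: (aux _ _ _ _ gt jt (esym E)).
split=> // ltjt; apply: val_inj; subst j'.
have := congr1 (fun a => val (tnth a ord_max)) E; rewrite /= !val_omit /= /bump.
by rewrite (ltjt : j <= s)%N add1n ltnn => /addnI.
Qed.

Lemma omit_last k k' : omit k t = omit k' t.
Proof.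
apply: eq_from_tnth => i; apply: val_inj; by rewrite /= !val_omit bump_ord ltn_ord.
Qed.

Lemma idx_omit_t k j : (j <= t)%N -> idx (omit k j) t = if j == t then t else (t + k).+1.
Proof.
move=> jt; have -> : idx (omit k j) t = (tnth (omit k j) ord_max).+1 by exact: (idxS _ ord_max).
rewrite val_omit /= /bump.
by case: eqP => ?; case: (leqP j s) => ?; rewrite ?add0n ?add1n; case: ifP => ?; lia.
Qed.

Lemma idx_omit_s k j : (j <= t)%N -> (idx (omit k j) s <= t)%N /\ (idx (omit k j) s == s) = (s <= j)%N.
Proof.
case: (posnP s) => [s0 jt|s0 jt].
  have -> : idx (omit k j) s = idx (omit k j) 0 by congr (idx _ _).
  by rewrite /=; split; lia.
have lt1 : (s.-1 < t)%N by lia.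
have -> : idx (omit k j) s = idx (omit k j) (Ordinal lt1).+1 by congr (idx _ _); rewrite /= prednK.
rewrite idxS val_omit /= /bump.
by case: (leqP j s.-1) => ?; rewrite ?add0n ?add1n; case: ifP => ?; split; lia.
Qed.

(** The first [s] entries are increasing in 0, ..., s, so they miss exactly one value; only the last
    entry can lie beyond. *)
Lemma inc_omit a : a \in inc_tuples t (t + p.+1) -> (idx a s <= t)%N ->
  exists k j, (j <= t)%N /\ a = omit k j.
Proof.
move=> /inc_tuplesP ia ias.
have lo (i : 'I_t) : (i <= tnth a i)%N.
  case: i => i it; elim: i it => // i IH it.
  have it' := ltnW it; apply: leq_trans (ia (Ordinal it') (Ordinal it) (leqnn _)).
  by rewrite ltnS; apply: IH.
have hi (i : 'I_t) : (i < s)%N -> (tnth a i <= i.+1)%N.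
  move=> lis; have [d Ed] : exists d, s = (i + d).+1 by exists (s - i.+1)%N; lia.
  elim: d i lis Ed => [|d IH] i lis Ed.
    have Es : i.+1 = s by rewrite addn0 in Ed.
    have : (idx a i.+1 <= t)%N by rewrite Es.
    by rewrite idxS ltnS Es.
  have it : (i.+1 < t)%N by lia.
  have := IH (Ordinal it) ltac:(rewrite /=; lia) ltac:(rewrite /=; lia).
  have := ia i (Ordinal it) (leqnn _); rewrite /=; lia.
(* A last entry below [t] forces the tuple 0, ..., s, which is [omit 0 t]. *)
pose as_ := tnth a ord_max; case: (leqP t as_) => Has; last first.
  exists 0, t; split=> //; apply: eq_from_tnth => i; apply: val_inj; rewrite /= val_omit bump_ord ltn_ord.
  apply/eqP; rewrite eqn_leq lo andbT.
  have [d Ed] : exists d, s = (i + d)%N by exists (s - i)%N; have := ltn_ord i; lia.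
  elim: d i Ed => [|d IH] i Ed.
    suff -> : i = ord_max by rewrite /=; rewrite ltnS in Has.
    by apply: val_inj; rewrite addn0 in Ed; rewrite /= -Ed.
  have it : (i.+1 < t)%N by lia.
  have := IH (Ordinal it) ltac:(rewrite /=; lia).
  have := ia i (Ordinal it) (leqnn _); rewrite /=; lia.
have ltk : (as_ - t < p.+1)%N by have := ltn_ord as_; lia.
(* The omitted index is the first position whose entry exceeds it; the disjunct [s <= j] covers the
   case where only the last entry jumps. *)
have [j [jP jmin]] := @least_nat (fun j => (s <= j)%N \/ exists i : 'I_t, i = j :> nat /\ (j < tnth a i)%N)
  (ex_intro _ s (or_introl (leqnn _))).
have jt : (j < t)%N by case: jP => [sj|[i [<- _]]] //; rewrite ltnS leqNgt; apply/negP => /jmin; case; left.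
exists (Ordinal ltk), j; split; first exact: ltnW.
apply: eq_from_tnth => i; apply: val_inj; rewrite /= val_omit /bump /=.
case: (leqP j i) => [ji|ij]; last first.
  rewrite add0n ltn_ord; apply/eqP; rewrite eqn_leq lo andbT leqNgt; apply/negP => H.
  by apply: (jmin _ ij); right; exists i.
rewrite add1n ltnS; case: ltnP => [lis|lsi]; last first.
  have -> : i = ord_max by apply: val_inj => /=; have := ltn_ord i; lia.
  by rewrite subnKC.
apply/eqP; rewrite eqn_leq hi //=.
case: jP => [sj|[i0 [Ei0 H0]]]; first lia.
have step (i' : 'I_t) d : i' = (i0 + d)%N :> nat -> (i' < tnth a i')%N.
  elim: d i' => [|d IH] i' Ei'.
    by have -> : i' = i0; [apply: val_inj; rewrite /= Ei' addn0|rewrite Ei0].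
  have it : (i0 + d < t)%N by have := ltn_ord i'; lia.
  have := IH (Ordinal it) erefl; have := ia (Ordinal it) i'; rewrite /=; lia.
by apply: (step i (i - i0)%N); lia.
Qed.

End OneRowReplaced.

Arguments bord {s p} k u.
Arguments omit {s p} k j.

(** * The set Phi_0 *)

Section Phi0Index.
Variables (K : fieldType) (s p q : nat).
Local Notation t := s.+1.
Local Notation m := (t + p.+1)%N.
Local Notation n := (t + q.+1)%N.

(** Conditions (i) to (iv) in terms of the omitted indices; the bounds by [t] in (iii) and (iv) come
    from [idx_omit_s]. *)
Lemma in_Phi0_omit (k : 'I_p.+1) (l : 'I_q.+1) j i : (j <= t)%N -> (i <= t)%N ->
  @in_Phi0 m n t (omit k j) (omit l i) =
  [|| ((j == t) || (k == 0)) && ((i == t) || (l == 0)), (s <= j)%N && (s <= i)%N, j == t | i == t].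
Proof.
move=> jt it; rewrite /in_Phi0 -[t.-1]/s !idx_omit_t //.
have [-> ->] := idx_omit_s k jt; have [-> ->] := idx_omit_s l it.
have le1 r (x : 'I_r.+1) y : (y <= t)%N ->
    ((if y == t then t else (t + x).+1) <= t.+1)%N = (y == t) || (x == 0).
  move=> yt; rewrite -val_eqE /=; case: eqP => _; first by rewrite leqnSn.
  by rewrite ltnS -[X in (_ <= X)%N]addn0 leq_add2l leqn0.
have eq1 r (x : 'I_r.+1) y : ((if y == t then t else (t + x).+1) == t) = (y == t).
  case: (y =P t) => _; first by rewrite eqxx.
  by apply/negbTE; rewrite neq_ltn ltnS leq_addr orbT.
by rewrite !le1 // !eq1 andbT.
Qed.

(* The index pair of the element of [Phi_0] that determines the entry [(i, j)] of [coords]. *)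
Definition phi_idx (ij : 'I_m * 'I_n) : t.-tuple 'I_m * t.-tuple 'I_n :=
  match split ij.1, split ij.2 with
  | inl i, inl j => (omit 0 j, omit 0 i)
  | inl i, inr l => (omit 0 t, omit l i)
  | inr k, inl j => (omit k j, omit 0 t)
  | inr k, inr l => if (k == 0) && (l == 0) then (omit 0 t, omit 0 t) else (omit k s, omit l s)
  end.

Lemma phi_idx_inj : injective phi_idx.
Proof.
have ne u (x : 'I_u) : x != u :> nat by rewrite ltn_eqF.
have le (i : 'I_t) : (i <= t)%N by apply: ltnW.
have lt_ss : (s < t)%N by [].
have le_ss : (s <= t)%N by [].
have inj u (k k' : 'I_u.+1) (i i' : 'I_t) : @omit s _ k i = omit k' i' -> k = k' /\ i = i'.
  by move=> /omit_inj [] // E E'; split; [exact: E'|exact: val_inj].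
have injt u (k k' : 'I_u.+1) (i : 'I_t) : @omit s _ k i = omit k' t -> False.
  by move=> /omit_inj [] // E _; have := ne _ i; rewrite E eqxx.
have injt' u (k k' : 'I_u.+1) (i : 'I_t) : @omit s _ k t = omit k' i -> False by move/esym/injt.
have injs u (k k' : 'I_u.+1) : @omit s _ k s = omit k' s -> k = k' by case/omit_inj => // _; apply.
have injst u (k k' : 'I_u.+1) : @omit s _ k s = omit k' t -> False.
  by move=> /omit_inj [] // E _; have := ltnn s; rewrite {2}E ltnSn.
have injts u (k k' : 'I_u.+1) : @omit s _ k t = omit k' s -> False by move/esym/injst.
have injis u (k k' : 'I_u.+1) (i : 'I_t) : @omit s _ k i = omit k' s -> k = k'.
  by move=> /omit_inj [] // _; apply.
have injsi u (k k' : 'I_u.+1) (i : 'I_t) : @omit s _ k s = omit k' i -> k = k'.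
  by move=> /omit_inj [] // _; apply.
move=> [i j] [i' j']; rewrite /phi_idx /=.
case: (split_ordP i) => x ->; case: (split_ordP j) => y ->;
  case: (split_ordP i') => x' ->; case: (split_ordP j') => y' ->;
  do ?[case: ifP => [/andP[/eqP -> /eqP ->]|?]]; move=> E;
  have /= E1 := congr1 fst E; have /= E2 := congr1 snd E.
all: try solve [case: (injt _ _ _ _ E1)|case: (injt _ _ _ _ E2)|case: (injt' _ _ _ _ E1)
  |case: (injt' _ _ _ _ E2)|case: (injst _ _ _ E1)|case: (injts _ _ _ E1)
  |case: (injst _ _ _ E2)|case: (injts _ _ _ E2)].
- by have [_ ->] := inj _ _ _ _ _ E1; have [_ ->] := inj _ _ _ _ _ E2.
(* A pair from the upper left block equals (omit k s, omit l s) only if k = l = 0, the case that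
   [phi_idx] treats apart. *)
- match goal with H : _ = false |- _ => move: H end.
  by rewrite -(injis _ _ _ _ E1) -(injis _ _ _ _ E2) eqxx.
- by have [-> ->] := inj _ _ _ _ _ E2.
- by have [-> ->] := inj _ _ _ _ _ E1.
- match goal with H : _ = false |- _ => move: H end.
  by rewrite (injsi _ _ _ _ E1) (injsi _ _ _ _ E2) eqxx.
- by [].
- by rewrite (injs _ _ _ E1) (injs _ _ _ E2).
Qed.

Lemma phi_idx_in ij : [/\ (phi_idx ij).1 \in inc_tuples t m, (phi_idx ij).2 \in inc_tuples t n &
  in_Phi0 (phi_idx ij).1 (phi_idx ij).2].
Proof.
have le (i : 'I_t) : (i <= t)%N by apply: ltnW.
case: ij => i j; rewrite /phi_idx /=.
case: (split i) => x; case: (split j) => y; try (case: ifP => _);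
  split; try exact: omit_inc; rewrite in_Phi0_omit ?le ?leqnSn // ?eqxx ?orbT ?leqnn ?leqnSn //.
by rewrite /= orbT.
Qed.

Lemma phi_idx_surj (a : t.-tuple 'I_m) (b : t.-tuple 'I_n) :
  a \in inc_tuples t m -> b \in inc_tuples t n -> in_Phi0 a b -> exists ij, (a, b) = phi_idx ij.
Proof.
(* Strict growth turns each of the four conditions into the bound on both last but one indices that
   [inc_omit] requires. *)
move=> ia ib Hab; have mono r (c : t.-tuple 'I_r) : c \in inc_tuples t r ->
    (idx c s < idx c t)%N.
  move/inc_tuplesP => ic; have -> : idx c t = (tnth c ord_max).+1 by exact: (idxS c ord_max).
  case: (posnP s) => [s0|s0]; first by have -> : idx c s = idx c 0 by congr (idx _ _).
  have lt1 : (s.-1 < t)%N by lia.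
  have -> : idx c s = idx c (Ordinal lt1).+1 by congr (idx _ _); rewrite /= prednK.
  by rewrite idxS ltnS; apply: ic => /=; lia.
have [les_a les_b] : (idx a s <= t)%N /\ (idx b s <= t)%N.
  have := mono _ _ ia; have := mono _ _ ib; move: Hab; rewrite /in_Phi0 -[t.-1]/s; lia.
have [k [j [jt Ea]]] := inc_omit ia les_a; have [l [i [it Eb]]] := inc_omit ib les_b.
move: Hab; rewrite Ea Eb in_Phi0_omit //.
have E0 u (x : 'I_u.+1) : omit x t = omit 0 t := omit_last _ x 0.
case: (ltngtP j t) jt => // [lt_j _|-> _]; case: (ltngtP i t) it => // [lt_i _|-> _].
- rewrite !orbF /= => H; case: (boolP ((k == 0) && (l == 0))) H => [/andP[/eqP -> /eqP ->] _|nz].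
    by exists (lshift _ (Ordinal lt_i), lshift _ (Ordinal lt_j)); rewrite /phi_idx /= !(unsplitK (inl _)).
  (* Off the corner k = l = 0 only condition (ii) can hold here. *)
  move=> /= H; have [-> ->] : j = s /\ i = s by move: nz H lt_i lt_j; clear; lia.
  exists (rshift _ k, rshift _ l); rewrite /phi_idx /= !(unsplitK (inr _)).
  by rewrite (negPf nz).
- by exists (rshift _ k, lshift _ (Ordinal lt_j)); rewrite /phi_idx /= (unsplitK (inr _)) (unsplitK (inl _)) (E0 _ l).
- by exists (lshift _ (Ordinal lt_i), rshift _ l); rewrite /phi_idx /= (unsplitK (inr _)) (unsplitK (inl _)) (E0 _ k).
- by exists (rshift _ 0, rshift _ 0); rewrite /phi_idx /= !(unsplitK (inr _)) eqxx (E0 _ k) (E0 _ l).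
Qed.

Lemma mem_Phi0 g : reflect (exists ij, g = minor K (phi_idx ij).1 (phi_idx ij).2)
  (g \in Phi0 K m n t).
Proof.
apply: (iffP mapP) => [[[a b]]|[ij ->]].
  rewrite mem_filter /= => /andP[Hab /allpairsP[[a' b'] /= [ia ib [Ea Eb]]]] ->; subst a' b'.
  by have [ij E] := phi_idx_surj ia ib Hab; exists ij; rewrite -E.
have [ia ib Hab] := phi_idx_in ij; exists (phi_idx ij) => //.
by rewrite mem_filter Hab /=; apply/allpairsP; exists (phi_idx ij); split=> //; case: (phi_idx ij).
Qed.

Lemma size_undup_Phi0 : size (undup (Phi0 K m n t)) = (m * n)%N.
Proof.
pose h ij := minor K (phi_idx ij).1 (phi_idx ij).2.
have h_inj : injective h.
  move=> x y /minor_inj E; apply: phi_idx_inj; have [ia ib _] := phi_idx_in x.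
  have [ia' ib' _] := phi_idx_in y; have [] := E ia ia' ib ib'.
  by case: (phi_idx x) => ? ?; case: (phi_idx y) => ? ? /= -> ->.
transitivity (size (map h (enum {: 'I_m * 'I_n}))); last first.
  by rewrite size_map -cardE card_prod !card_ord.
apply/perm_size/uniq_perm; [exact: undup_uniq|by rewrite map_inj_uniq ?enum_uniq|move=> g].
rewrite mem_undup; apply/mem_Phi0/mapP => [[ij ->]|[ij _ ->]]; exists ij => //.
by rewrite mem_enum.
Qed.

End Phi0Index.

(** * Bordered minors *)

Lemma adj_castmx (R : comNzRingType) r r' (e : r = r') (A : 'M[R]_r) :
  \adj (castmx (e, e) A) = castmx (e, e) (\adj A).
Proof. by case: _ / e; rewrite !castmx_id. Qed.

Lemma det_castmx (R : comNzRingType) r r' (e : r = r') (A : 'M[R]_r) :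
  \det (castmx (e, e) A) = \det A.
Proof. by case: _ / e; rewrite castmx_id. Qed.

Section BorderedMinors.
Variables (F : fieldType) (s p q : nat) (X : 'M[F]_(s.+1 + p.+1, s.+1 + q.+1)).
Local Notation t := s.+1.

Lemma bord_lshift r (k : 'I_r.+1) (i : 'I_t) : bord k i = lshift r.+1 i.
Proof. by apply: val_inj; rewrite /= val_bord ltn_ord. Qed.

Lemma bord_rshift r (k : 'I_r.+1) : bord k t = rshift t k.
Proof. by apply: val_inj; rewrite /= val_bord ltnn. Qed.

Definition bordered (k : 'I_p.+1) (l : 'I_q.+1) : 'M[F]_t.+1 :=
  \matrix_(u, v) X (bord k u) (bord l v).

Lemma bordered_block k l :
  bordered k l = castmx (addn1 t, addn1 t)
    (block_mx (topleft X) (col l (ursubmx X)) (row k (dlsubmx X)) (drsubmx X k l)%:M).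
Proof.
have nat_cast (u : 'I_t.+1) : u = cast_ord (esym (addn1 t)) u :> nat by [].
apply/matrixP => u v; rewrite castmxE mxE /= (nat_cast u) (nat_cast v).
case: (split_ordP (cast_ord (esym (addn1 t)) u)) => i ->; case: (split_ordP (cast_ord (esym (addn1 t)) v)) => j ->.
- by rewrite block_mxEul /= !bord_lshift !mxE.
- by rewrite block_mxEur /= ord1 /= addn0 bord_lshift bord_rshift !mxE.
- by rewrite block_mxEdl /= ord1 /= addn0 bord_lshift bord_rshift !mxE.
- by rewrite block_mxEdr /= !ord1 /= addn0 !bord_rshift !mxE.
Qed.

Hypothesis uU : topleft X \in unitmx.

Lemma schur_bordered k l :
  ((drsubmx X k l)%:M - row k (dlsubmx X) *m invmx (topleft X) *m col l (ursubmx X)) 0 0 =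
  schur X k l.
Proof.
rewrite /schur /lowfac -row_mul !mxE eqxx mulr1n; congr (_ - _).
by apply: eq_bigr => j _; rewrite !mxE.
Qed.

Lemma det_bordered k l : \det (bordered k l) = \det (topleft X) * schur X k l.
Proof. by rewrite bordered_block det_castmx det_schur // det_mx11 schur_bordered. Qed.

(** [ord_max] is the border position and [lift ord_max i] the position [i] of the top left block. *)
Lemma adj_bordered_entries k l : schur X k l != 0 -> [/\
  \adj (bordered k l) ord_max ord_max = \det (topleft X),
  forall i, \adj (bordered k l) (lift ord_max i) ord_max = - (\det (topleft X) * upfac X i l),
  forall j, \adj (bordered k l) ord_max (lift ord_max j) = - (\det (topleft X) * lowfac X k j) &
  forall i j, \adj (bordered k l) (lift ord_max i) (lift ord_max j) =
    \det (topleft X) * (schur X k l * invmx (topleft X) i j + upfac X i l * lowfac X k j)].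
Proof.
move=> s0; rewrite -schur_bordered in s0; have [_ E] := adj_bordered uU s0.
rewrite schur_bordered in E.
have castl (i : 'I_t) : cast_ord (esym (addn1 t)) (lift ord_max i) = lshift 1 i.
  by apply: val_inj; rewrite /= bump_ord.
have castr : cast_ord (esym (addn1 t)) ord_max = rshift t ord0.
  by apply: val_inj; rewrite /= addn0.
have -> : \adj (bordered k l) = castmx (addn1 t, addn1 t) (\det (topleft X) *:
    block_mx (schur X k l *: invmx (topleft X) + col l (upfac X) *m row k (lowfac X))
             (- col l (upfac X)) (- row k (lowfac X)) 1%:M).
  by rewrite bordered_block adj_castmx E /upfac /lowfac row_mul !colE !mulmxA.
split=> [|i|j|i j]; rewrite castmxE /= ?castl ?castr mxE.
- by rewrite block_mxEdr mxE eqxx mulr1.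
- by rewrite block_mxEur 2![in LHS]mxE mulrN.
- by rewrite block_mxEdl 2![in LHS]mxE mulrN.
- rewrite block_mxEul mxE [X in _ * (X + _)]mxE [X in _ * (_ + X)]mxE big_ord1.
  by congr (_ * (_ + _ * _)); rewrite mxE.
Qed.

End BorderedMinors.

(** * Subalgebras of the field of fractions *)

Section FractionSubalgebras.
Variables (K : fieldType) (N : nat).
Local Notation P := {mpoly K[N]}.
Local Notation L := {fraction P}.
Local Notation tofrac := (@FracField.tofrac P).
Implicit Types S : L -> Prop.

Definition subalg S : Prop :=
  [/\ forall c : K, S (tofrac c%:MP), forall x y, S x -> S y -> S (x + y)
    & forall x y, S x -> S y -> S (x * y)].

Variable S : L -> Prop.
Hypothesis aS : subalg S.

Lemma subalg_const (c : K) : S (tofrac c%:MP).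
Proof. by case: aS. Qed.

Lemma subalg0 : S 0.
Proof. by have := subalg_const 0; rewrite mpolyC0 tofrac0. Qed.

Lemma subalg1 : S 1.
Proof. by have := subalg_const 1; rewrite mpolyC1 tofrac1. Qed.

Lemma subalgM x y : S x -> S y -> S (x * y).
Proof. by case: aS => _ _; apply. Qed.

Lemma subalgD x y : S x -> S y -> S (x + y).
Proof. by case: aS => _ + _; apply. Qed.

Lemma subalgN x : S x -> S (- x).
Proof.
move=> Sx; rewrite -mulN1r; apply: subalgM => //.
by have := subalg_const (-1); rewrite mpolyCN mpolyC1 tofracN tofrac1.
Qed.

Lemma subalgB x y : S x -> S y -> S (x - y).
Proof. by move=> Sx Sy; apply: subalgD => //; apply: subalgN. Qed.

Lemma subalgX x k : S x -> S (x ^+ k).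
Proof. by move=> Sx; elim: k => [|k IH]; [exact: subalg1|rewrite exprS; apply: subalgM]. Qed.

Lemma subalg_det r (A : 'M[L]_r) : (forall i j, S (A i j)) -> S (\det A).
Proof.
move=> SA; apply: (big_ind S) => [||u _]; [exact: subalg0|exact: subalgD|].
apply: subalgM; first by apply: subalgX; apply: subalgN; apply: subalg1.
by apply: (big_ind S) => [||i _]; [exact: subalg1|exact: subalgM|].
Qed.

Lemma subalg_frac_min (G : seq P) : (forall g, g \in G -> S (tofrac g)) ->
  forall x, in_frac (in_subalg G) x -> S x.
Proof.
move=> SG x [f [Hf ->]]; elim: Hf => [c|g /SG //|a b _ Sa _ Sb|a b _ Sa _ Sb].
- exact: subalg_const.
- by rewrite tofracD; apply: subalgD.
- by rewrite tofracM; apply: subalgM.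
Qed.

Lemma subalg_invert f : f != 0 -> S f -> subalg (invert S f).
Proof.
move=> f0 Sf; split=> [c|x y [a [k [Sa ->]]] [b [l [Sb ->]]]|x y [a [k [Sa ->]]] [b [l [Sb ->]]]].
- by exists (tofrac c%:MP), 0%N; rewrite expr0 divr1; split=> //; apply: subalg_const.
- exists (a * f ^+ l + b * f ^+ k), (k + l)%N; split.
    by apply: subalgD; apply: subalgM => //; apply: subalgX.
  by rewrite exprD addf_div ?expf_neq0.
- exists (a * b), (k + l)%N; split; first exact: subalgM.
  by rewrite exprD mulf_div.
Qed.

Lemma invert_min (A : L -> Prop) f :
  (forall x, A x -> S x) -> S f^-1 -> forall x, invert A f x -> S x.
Proof.
move=> AS Sf x [a [k [Aa ->]]]; rewrite -exprVn.
by apply: subalgM; [apply: AS|apply: subalgX].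
Qed.

Lemma subalg_ev (y : nat -> L) (iota : {rmorphism K -> L}) r (f : T K r) :
  (forall c, iota c = tofrac c%:MP) -> (forall i, S (y i)) -> S (ev iota y r f).
Proof.
move=> Ei Sy; elim: r f => [|r IH] f; first by rewrite /= Ei; apply: subalg_const.
elim/poly_ind: f => [|f a IHf]; first by rewrite !rmorph0; apply: subalg0.
rewrite !evS !rmorphD !rmorphM /= !map_polyX !map_polyC !hornerD !hornerM !hornerX !hornerC.
by apply: subalgD; [apply: subalgM|apply: IH].
Qed.

End FractionSubalgebras.

Lemma subalg_in_frac (K : fieldType) (N : nat) (G : seq {mpoly K[N]}) :
  subalg (in_frac (in_subalg G)).
Proof.
split=> [c|_ _ [a [Ga ->]] [b [Gb ->]]|_ _ [a [Ga ->]] [b [Gb ->]]].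
- by exists c%:MP; split=> //; apply: sa_const.
- by exists (a + b); split; [apply: sa_add|rewrite tofracD].
- by exists (a * b); split; [apply: sa_mul|rewrite tofracM].
Qed.

Lemma in_frac_gen (K : fieldType) (N : nat) (G : seq {mpoly K[N]}) g :
  g \in G -> in_frac (in_subalg G) (FracField.tofrac g).
Proof. by move=> Gg; exists g; split=> //; apply: sa_gen. Qed.

(** * Comparison of the algebras *)

Section MainTheorem.
Variables (K : closedFieldType) (s p q : nat).
Local Notation t := s.+1.
Local Notation m := (t + p.+1)%N.
Local Notation n := (t + q.+1)%N.
Local Notation P := {mpoly K[m * n]}.
Local Notation L := {fraction P}.
Local Notation tofrac := (@FracField.tofrac P).
Local Notation X := (generic_mx K s p q).
Local Notation d := (\det (topleft X)).
Local Notation A := (in_frac (in_subalg (all_minors K m n t))).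
Local Notation APhi := (in_frac (in_subalg (Phi0 K m n t))).
Local Notation F := (tofrac (Fdet K m n t)).
Local Notation phi := (ev (iotaL K s p q) (entries (coords X)) (m * n)).

Lemma generic_mxE i j : X i j = tofrac (Xe K m n i j).
Proof. by rewrite mxE XeE. Qed.

Lemma tofrac_gen_minor r (f : 'I_r -> 'I_m) (g : 'I_r -> 'I_n) :
  tofrac (gen_minor K f g) = \det (mxsub f g X).
Proof.
by rewrite /gen_minor -det_map_mx; congr (\det _); apply/matrixP => i j; rewrite [LHS]mxE [in LHS]mxE [RHS]mxE generic_mxE.
Qed.

Lemma det_generic_mx_neq0 r (f : 'I_r -> 'I_m) (g : 'I_r -> 'I_n) :
  injective f -> injective g -> \det (mxsub f g X) != 0.
Proof. by move=> fi gi; rewrite -tofrac_gen_minor tofrac_eq0 gen_minor_neq0. Qed.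

Lemma topleft_generic_mx_unit : topleft X \in unitmx.
Proof.
rewrite unitmxE unitfE; have := @det_generic_mx_neq0 t (lshift _) (lshift _) (@lshift_inj _ _) (@lshift_inj _ _).
by congr (\det _ != 0); apply/matrixP => i j; rewrite !mxE.
Qed.

Let d_neq0 : d != 0 := det_topleft_neq0 topleft_generic_mx_unit.

Lemma bord_inj r (k : 'I_r.+1) : injective (fun u : 'I_t.+1 => @bord s r k u).
Proof.
move=> u v /(congr1 val); rewrite /= !val_bord => E; apply: val_inj => /=.
by move: E; have := ltn_ord u; have := ltn_ord v; repeat case: ifP => ?; lia.
Qed.

Lemma schur_generic_mx_neq0 k l : schur X k l != 0.
Proof.
have : \det (bordered X k l) != 0.
  have := det_generic_mx_neq0 (@bord_inj p k) (@bord_inj q l).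
  by congr (\det _ != 0); apply/matrixP => i j; rewrite !mxE.
by rewrite (det_bordered topleft_generic_mx_unit) mulf_eq0 negb_or => /andP[_ H]; exact: H.
Qed.

(** The adjugate transposes: its column [y] is the omitted row and its row [x] the omitted
    column. *)
Lemma adj_bordered_minor k l x y :
  \adj (bordered X k l) x y = (-1) ^+ (y + x) * tofrac (minor K (omit k y) (omit l x)).
Proof.
rewrite mxE /cofactor; congr (_ * _); rewrite /minor -det_map_mx; congr (\det _).
by apply/matrixP => u v; rewrite 3![LHS]mxE [RHS]mxE [in RHS]mxE !tnth_mktuple generic_mxE.
Qed.

Lemma APhi_adj k l (x y : 'I_t.+1) :
  [|| ((y == t :> nat) || (k == 0)) && ((x == t :> nat) || (l == 0)), (s <= y)%N && (s <= x)%N,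
      y == t :> nat | x == t :> nat] -> APhi (\adj (bordered X k l) x y).
Proof.
move=> H; rewrite adj_bordered_minor; have aA := subalg_in_frac (Phi0 K m n t).
apply: (subalgM aA).
  by apply: (subalgX aA); apply: (subalgN aA); apply: (subalg1 aA).
apply: in_frac_gen; apply/mem_Phi0.
have [|ij E] := @phi_idx_surj s p q (omit k y) (omit l x) (omit_inc _ _ _) (omit_inc _ _ _).
  have le (z : 'I_t.+1) : (z <= t)%N by have := ltn_ord z.
  by rewrite in_Phi0_omit ?le.
by exists ij; rewrite -E.
Qed.

Lemma tofrac_delta r : tofrac (delta K m n r) = \det (\matrix_(k < r, l < r) tofrac (Xe K m n k l)).
Proof. by rewrite -det_map_mx; congr (\det _); apply/matrixP => i j; rewrite !mxE. Qed.

(** The factors of F are d (U^-1)_tt, d and d sigma, and sigma (U^-1)_tt = N_tt. *)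
Lemma F_coords : F = d ^+ 3 * scinv X ord_max ord_max.
Proof.
have Et : tofrac (delta K m n t) = d.
  rewrite tofrac_delta; congr (\det _); apply/matrixP => i j.
  by rewrite [LHS]mxE /topleft [RHS]mxE [RHS]mxE generic_mxE.
have EtS : tofrac (delta K m n t.+1) = d * pivot X.
  rewrite -(det_bordered topleft_generic_mx_unit) tofrac_delta; congr (\det _).
  have Eb r (u : 'I_t.+1) : u = @bord s r 0 u :> nat.
    by rewrite val_bord; have := ltn_ord u; rewrite /= addn0; case: ifP => ?; lia.
  by apply/matrixP => i j; rewrite [LHS]mxE [RHS]mxE generic_mxE [in LHS](Eb p i) [in LHS](Eb q j).
have Etp : tofrac (delta K m n s) = d * invmx (topleft X) ord_max ord_max.
  have -> : d * invmx (topleft X) ord_max ord_max = \adj (topleft X) ord_max ord_max.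
    by rewrite /invmx topleft_generic_mx_unit mxE mulVKf.
  rewrite mxE /cofactor -signr_odd addnn odd_double mul1r tofrac_delta; congr (\det _).
  apply/matrixP => i j; rewrite [LHS]mxE 2![RHS]mxE /topleft 2![RHS]mxE generic_mxE /=.
  by rewrite !bump_ord.
rewrite /Fdet !tofracM Et EtS Etp /scinv mxE.
have swap (R : comNzRingType) (x y z : R) : x * y * x * (x * z) = x ^+ 3 * (z * y) by ring.
exact: swap.
Qed.

Lemma delta_neq0 r : (r <= m)%N -> (r <= n)%N -> delta K m n r != 0.
Proof.
have widen_inj u v (le_uv : (u <= v)%N) : injective (widen_ord le_uv).
  by move=> x y /(congr1 val) /= E; apply: val_inj.
by move=> rm rn; apply: (gen_minor_neq0 K (widen_inj _ _ rm) (widen_inj _ _ rn)).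
Qed.

Lemma F_neq0 : F != 0.
Proof. by rewrite tofrac_eq0 !mulf_neq0 ?delta_neq0 //=; lia. Qed.

Let N_neq0 : scinv X ord_max ord_max != 0.
Proof. by have := F_neq0; rewrite F_coords mulf_eq0 negb_or => /andP[_ H]; exact: H. Qed.

Let aA : subalg APhi := subalg_in_frac (Phi0 K m n t).

Lemma APhi_topleft : APhi d.
Proof.
have [E _ _ _] := adj_bordered_entries topleft_generic_mx_unit (schur_generic_mx_neq0 0 0).
by rewrite -E; apply: APhi_adj; rewrite !eqxx !orbT.
Qed.

Lemma APhi_upfac i l : APhi (d * upfac X i l).
Proof.
have [_ E _ _] := adj_bordered_entries topleft_generic_mx_unit (schur_generic_mx_neq0 0 l).
by rewrite -[_ * _]opprK -E; apply: (subalgN aA); apply: APhi_adj; rewrite /= eqxx !orbT.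
Qed.

Lemma APhi_lowfac k j : APhi (d * lowfac X k j).
Proof.
have [_ _ E _] := adj_bordered_entries topleft_generic_mx_unit (schur_generic_mx_neq0 k 0).
by rewrite -[_ * _]opprK -E; apply: (subalgN aA); apply: APhi_adj; rewrite /= eqxx !orbT.
Qed.

Lemma APhi_scinv i j : APhi (d * (scinv X i j + upfac X i 0 * lowfac X 0 j)).
Proof.
have [_ _ _ E] := adj_bordered_entries topleft_generic_mx_unit (schur_generic_mx_neq0 0 0).
rewrite [scinv X i j]mxE /pivot -E; apply: APhi_adj; by rewrite eqxx !orbT.
Qed.

Lemma APhi_schur k l : APhi (d * (schur X k l * invmx (topleft X) ord_max ord_max +
                                  upfac X ord_max l * lowfac X k ord_max)).
Proof.
have [_ _ _ E] := adj_bordered_entries topleft_generic_mx_unit (schur_generic_mx_neq0 k l).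
have le_s : lift ord_max (@ord_max s) = s :> nat := bump_ord ord_max.
by rewrite -E; apply: APhi_adj; rewrite le_s leqnn !orbT.
Qed.

(** The Desnanot-Jacobi identity: this element is the product of the leading minors of sizes t - 1
    and t + 1, written through four t-minors from Phi_0. *)
Lemma APhi_desnanot : APhi (d ^+ 2 * scinv X ord_max ord_max).
Proof.
have expand (R : comNzRingType) (x y u v : R) :
  x ^+ 2 * y = x * (x * (y + u * v)) - (x * u) * (x * v) by ring.
rewrite (expand _ _ _ (upfac X ord_max 0) (lowfac X 0 ord_max)); apply: (subalgB aA).
  by apply: (subalgM aA); [exact: APhi_topleft|exact: APhi_scinv].
by apply: (subalgM aA); [exact: APhi_upfac|exact: APhi_lowfac].
Qed.

Lemma APhi_F : APhi F.
Proof.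
rewrite F_coords exprS -mulrA; apply: (subalgM aA); [exact: APhi_topleft|exact: APhi_desnanot].
Qed.

Local Notation B := (invert APhi F).

Let aB : subalg B := subalg_invert aA F_neq0 APhi_F.

Lemma APhi_sub_B x : APhi x -> B x.
Proof. by move=> Ax; exists x, 0%N; rewrite expr0 divr1. Qed.

Lemma B_invF : B F^-1.
Proof. by exists 1, 1%N; rewrite expr1 div1r; split=> //; apply: (subalg1 aA). Qed.

Lemma B_inv_topleft : B d^-1.
Proof.
have E (R : fieldType) (x y : R) : x != 0 -> y != 0 -> x^-1 = x ^+ 2 * y * (x ^+ 3 * y)^-1.
  by move=> x0 y0; field; rewrite ?x0 ?y0.
rewrite (E _ _ _ d_neq0 N_neq0) -F_coords; apply: (subalgM aB); last exact: B_invF.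
by apply: APhi_sub_B; apply: APhi_desnanot.
Qed.

Lemma B_div_topleft x : APhi (d * x) -> B x.
Proof.
move=> H; rewrite -[x](mulKf d_neq0); apply: (subalgM aB); first exact: B_inv_topleft.
exact: APhi_sub_B.
Qed.

(** The products b a in the bordered entries are subtracted once a and b are known to lie in [B]. *)
Lemma B_coords i j : B (coords X i j).
Proof.
have Bup i' l : B (upfac X i' l) := B_div_topleft (APhi_upfac i' l).
have Blow k j' : B (lowfac X k j') := B_div_topleft (APhi_lowfac k j').
case: (split_ordP i) => u ->; case: (split_ordP j) => v ->; rewrite /coords.
- rewrite block_mxEul -[scinv X u v](addrK (upfac X u 0 * lowfac X 0 v)).
  apply: (subalgB aB); first by apply: B_div_topleft; apply: APhi_scinv.
  by apply: (subalgM aB).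
- by rewrite block_mxEur.
- by rewrite block_mxEdl.
- rewrite block_mxEdr [set00 _ _ u v]mxE; case: ifP => _.
    by apply: APhi_sub_B; apply: APhi_topleft.
  have BN : B (scinv X ord_max ord_max)^-1.
    have E (R : fieldType) (x y : R) : x != 0 -> y != 0 -> y^-1 = x ^+ 3 * (x ^+ 3 * y)^-1.
      by move=> x0 y0; field; rewrite ?x0 ?y0.
    rewrite (E _ _ _ d_neq0 N_neq0) -F_coords; apply: (subalgM aB); last exact: B_invF.
    by apply: (subalgX aB); apply: APhi_sub_B; apply: APhi_topleft.
  (* With x = sigma, y = (U^-1)_tt and z = S_kl, the denominator x y is N_tt, whose inverse is d^3 /
     F. *)
  have E (R : fieldType) (x y z : R) : x * y != 0 -> x^-1 * z = z * y * (x * y)^-1.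
    by rewrite mulf_eq0 negb_or => /andP[x0 y0]; field; rewrite ?x0 ?y0.
  rewrite [nschur X u v]mxE; have N0 := N_neq0; rewrite [scinv X _ _]mxE in N0.
  rewrite (E _ _ _ _ N0); apply: (subalgM aB); last by rewrite [scinv X _ _]mxE in BN.
  have := subalgB aB (B_div_topleft (APhi_schur u v))
                  (subalgM aB (Bup ord_max v) (Blow u ord_max)).
  by rewrite addrK.
Qed.

Definition im_coords (x : L) : Prop := exists f, x = phi f.

Lemma im_coords_sub_B x : im_coords x -> B x.
Proof.
move=> [f ->]; apply: (subalg_ev aB) => // k; rewrite /entries.
case: insub => [u|]; last exact: (subalg0 aB).
by case/mxvec_indexP: u => i j; rewrite mxvecE; apply: B_coords.
Qed.

Lemma subalg_im : subalg im_coords.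
Proof.
split=> [c|_ _ [f ->] [g ->]|_ _ [f ->] [g ->]].
- by exists (cst K (m * n) c); rewrite ev_cst.
- by exists (f + g); rewrite (rmorphD phi).
- by exists (f * g); rewrite (rmorphM phi).
Qed.

Lemma im_coordsE i j : im_coords (coords X i j).
Proof. by exists (var K (m * n) (mxvec_index i j)); rewrite ev_var // entriesE. Qed.

Lemma im_coords_topleft : im_coords d.
Proof. by have := im_coordsE (rshift t 0) (rshift t 0); rewrite /coords block_mxEdr mxE. Qed.

Lemma im_coords_scinv i j : im_coords (scinv X i j).
Proof. by have := im_coordsE (lshift _ i) (lshift _ j); rewrite /coords block_mxEul. Qed.

Lemma im_coords_nschur k l : im_coords (nschur X k l).
Proof.
have := im_coordsE (rshift t k) (rshift t l); rewrite /coords block_mxEdr [set00 _ _ k l]mxE.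
case: ifP => // /andP[/eqP -> /eqP ->] _; rewrite mxE mulVf ?(schur_generic_mx_neq0 0 0) //.
exact: (subalg1 subalg_im).
Qed.

Lemma im_coords_minor (a : t.-tuple 'I_m) (b : t.-tuple 'I_n) : im_coords (tofrac (minor K a b)).
Proof.
have aI := subalg_im.
have -> : tofrac (minor K a b) = \det (mxsub (tnth a) (tnth b) X) := tofrac_gen_minor (tnth a) (tnth b).
have I1 r (i j : 'I_r) : im_coords (1%:M i j).
  by rewrite mxE; case: eqP => _; [exact: (subalg1 aI)|exact: (subalg0 aI)].
rewrite (minor_coords topleft_generic_mx_unit (schur_generic_mx_neq0 0 0)).
apply: (subalgM aI).
  apply: (subalgM aI); last exact: im_coords_topleft.
  by apply: (subalgX aI); apply: (subalgN aI); apply: (subalg1 aI).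
apply: (subalg_det aI) => i j.
case: (split_ordP i) => u ->; case: (split_ordP j) => v ->.
- by rewrite block_mxEul [X in im_coords X]mxE; apply: (subalgN aI); apply: im_coords_scinv.
- rewrite block_mxEur [colsub _ _ u v]mxE; case: (split_ordP (tnth b v)) => w ->.
    by rewrite row_mxEl; apply: I1.
  by have := im_coordsE (lshift _ u) (rshift t w); rewrite /coords block_mxEur row_mxEr.
- rewrite block_mxEdl [rowsub _ _ u v]mxE; case: (split_ordP (tnth a u)) => w ->.
    by rewrite col_mxEu; apply: I1.
  by have := im_coordsE (rshift t w) (lshift _ v); rewrite /coords block_mxEdl col_mxEd.
- rewrite block_mxEdr [mxsub _ _ _ u v]mxE.
  case: (split_ordP (tnth a u)) => w ->; case: (split_ordP (tnth b v)) => z ->.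
  + by rewrite block_mxEul mxE; apply: (subalg0 aI).
  + by rewrite block_mxEur mxE; apply: (subalg0 aI).
  + by rewrite block_mxEdl mxE; apply: (subalg0 aI).
  + by rewrite block_mxEdr; apply: im_coords_nschur.
Qed.

Lemma A_sub_im x : A x -> im_coords x.
Proof.
apply: (subalg_frac_min subalg_im) => g /allpairsP[[a b] /= [_ _ ->]]; exact: im_coords_minor.
Qed.

Lemma APhi_sub_A x : APhi x -> A x.
Proof.
apply: (subalg_frac_min (subalg_in_frac _)) => g /mem_Phi0[ij ->]; apply: in_frac_gen.
have [ia ib _] := phi_idx_in ij.
by apply/allpairsP; exists (phi_idx ij).
Qed.

Lemma invert_mono (S S' : L -> Prop) f x :
  (forall y, S y -> S' y) -> invert S f x -> invert S' f x.
Proof. by move=> SS' [a [k [/SS' Sa ->]]]; exists a, k. Qed.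

Lemma invert_A_sub x : invert A F x -> B x.
Proof. by apply: (invert_min aB) => [y /A_sub_im/im_coords_sub_B|]; last exact: B_invF. Qed.

(** The inclusions of A in [im_coords] and of [im_coords] in [B] make A[1/F] a localization of the
    image of [phi], which is a polynomial ring by [coords_indep]. *)
Lemma regular_invert_A : regular_ring (invert A F).
Proof.
have -> : invert A F = invert im_coords F.
  apply: functional_extensionality => x; apply: propositional_extensionality; split.
    exact/invert_mono/A_sub_im.
  move=> H; apply: (invert_mono APhi_sub_A); apply: (invert_min aB) H; last exact: B_invF.
  exact: im_coords_sub_B.
have [f Ef] : im_coords F.
  rewrite F_coords; apply: (subalgM subalg_im); last exact: im_coords_scinv.
  by apply: (subalgX subalg_im); apply: im_coords_topleft.
rewrite Ef; apply: regular_ring_image => //; first exact: coords_indep.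
by apply: contraNneq F_neq0 => f0; rewrite Ef f0 (rmorph0 phi).
Qed.

End MainTheorem.

Theorem theorem6p4 (K : closedFieldType) (m n t : nat) :
  [pchar K] =i pred0 -> (0 < t)%N -> (t < m)%N -> (m <= n)%N ->
  let At := in_frac (in_subalg (all_minors K m n t)) in
  let KPhi0 := in_frac (in_subalg (Phi0 K m n t)) in
  let F := FracField.tofrac (Fdet K m n t) in
  size (undup (Phi0 K m n t)) = (m * n)%N /\
  (forall x, invert KPhi0 F x <-> invert At F x) /\
  regular_ring (invert At F).
Proof.
move=> _; case: t => // s _ sm mn.
(* Since t < m <= n, at least one row and one column remain beyond the top left block. *)
have [p Em] : exists p, m = (s.+1 + p.+1)%N by exists (m - s.+2)%N; lia.
have [q En] : exists q, n = (s.+1 + q.+1)%N by exists (n - s.+2)%N; lia.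
subst m n => At KPhi0 F; split; first exact: size_undup_Phi0.
split=> [x|]; last exact: regular_invert_A.
by split; [apply/invert_mono/APhi_sub_A|apply: invert_A_sub].
Qed.
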